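(* Let $D$ be an inner control set of a control system $\Sigma$ with control range $U=U_0$, with associated increasing family of control ranges $\{U_\rho\}_{\rho\in[0,1]}$, and let $Q=\overline{D}$. Then for every nonempty compact set $K\subset D$, the pair $(K,Q)$ is admissible for the system with control range $U_1$. If moreover $\mathrm{int}\,K\ne\emptyset$, then for every $f\in C(U,\mathbb{R})$, extended to a continuous function $f\in C(U_1,\mathbb{R})$ (any extension), one has $$P_{out}(f,K,Q)=\lim_{\varepsilon\searrow0}\ \liminf_{\tau\to\infty}\frac1\tau\log a_\tau(f,K,N_\varepsilon(Q)),$$ where $P_{out}$ and $a_\tau$ are taken with respect to the system with control range $U_1$.
   Context: Setting: $M$ is a smooth manifold with a metric $\varrho$ compatible with its topology; $F:M\times\mathbb{R}^m\to TM$ is $C^1$ and $F(\cdot,u)$ is a vector field on $M$ for each control value $u$. For a compact control range $V\subset\mathbb{R}^m$, the control functions are the measurable functions $\omega:\mathbb{R}\to V$, and the control system with control range $V$ is $\dot x(t)=F(x(t),\omega(t))$; it is assumed that for each $x\in M$ and each control function $\omega$ there is a unique solution $\varphi(t,x,\omega)$, $\varphi(0,x,\omega)=x$, defined for all $t\in\mathbb{R}_+=[0,\infty)$. $\Sigma$ is the system with control range $U$. For a system with a given set $\mathcal{U}$ of control functions: $\mathcal{O}^+(x)=\{y:\ \exists\,t>0,\ \omega\in\mathcal{U}\text{ with }\varphi(t,x,\omega)=y\}$. A set $Q$ is controlled invariant if for all $x\in Q$ there is $\omega\in\mathcal{U}$ with $\varphi(t,x,\omega)\in Q$ for all $t\ge0$.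 A control set is a controlled invariant set $D$ with $D\subset\overline{\mathcal{O}^+(x)}$ for all $x\in D$ that is maximal among controlled invariant sets with this property. Inner control set: a control set $D\subset M$ of $\Sigma$ is an inner control set if there is an increasing family $\{U_\rho\}_{\rho\in[0,1]}$ of compact convex sets in $\mathbb{R}^m$ ($U_{\rho_1}\subset U_{\rho_2}$ for $\rho_1<\rho_2$) such that for every $\rho\in[0,1]$ the system with control range $U_\rho$ has a control set $D_\rho$ with nonvoid interior and compact closure, and: (i) $U=U_0$ and $D=D_0$; (ii) $\overline{D_{\rho_1}}\subset\mathrm{int}(D_{\rho_2})$ whenever $\rho_1<\rho_2$; (iii) for every neighborhood $W$ of $\overline{D}$ there is $\rho\in[0,1)$ with $\overline{D_\rho}\subset W$. A pair $(K,Q)$ of nonempty subsets of $M$ is admissible if $K$ is compact and for each $x\in K$ there is $\omega\in\mathcal{U}$ with $\varphi(\mathbb{R}_+,x,\omega)\subset Q$. For $\tau>0$, $\mathcal{S}\subset\mathcal{U}$ is $(\tau,K,Q)$-spanning if for all $x\in K$ there is $\omega\in\mathcal{S}$ with $\varphi(t,x,\omega)\in Q$ for all $t\in[0,\tau]$. For a continuous function $f$ from the control range to $\mathbb{R}$, $(S_\tau f)(\omega)=\int_0^\tau f(\omega(t))\,dt$, $$a_\tau(f,K,Q)=\inf\Big\{\sum_{\omega\in\mathcal{S}}e^{(S_\tau f)(\omega)};\ \mathcal{S}\ (\tau,K,Q)\text{-spanning}\Big\}\in[0,\infty],\qquad P_{inv}(f,K,Q)=\limsup_{\tau\to\infty}\frac1\tau\log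 a_\tau(f,K,Q).$$ For $Q$ closed, the outer invariance pressure is $P_{out}(f,K,Q)=\lim_{\varepsilon\to0}P_{inv}(f,K,N_\varepsilon(Q))$ (equivalently the supremum over $\varepsilon>0$), where $N_\varepsilon(Q)=\{y\in M;\ \exists x\in Q,\ \varrho(x,y)<\varepsilon\}$. $C(U,\mathbb{R})$ denotes the continuous functions $U\to\mathbb{R}$.
   Formalization: In condition (iii) of the definition of inner control set, ρ is taken in (0,1) instead of [0,1): as printed, ρ = 0 always works since D_0 = D, so the condition would be void and the sets D_ρ with ρ > 0 would not be tied to neighbourhoods of the closure of D. *)

(* Defs.v *)
From HB Require Import structures.
From mathcomp Require Import all_boot all_order all_algebra.
From mathcomp Require Import all_classical all_reals all_analysis.

Set Implicit Arguments.
Unset Strict Implicit.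
Unset Printing Implicit Defensive.

Import Order.TTheory GRing.Theory Num.Theory.
Import numFieldNormedType.Exports.

Local Open Scope classical_set_scope.
Local Open Scope ring_scope.

(* For V finite-dimensional and D open this is the usual notion: f is C^(k+1)
   iff it is differentiable and all its directional derivatives are C^k. *)
Fixpoint is_Ck (R : realType) (V W : normedModType R) (k : nat)
    (D : set V) (f : V -> W) : Prop :=
  match k with
  | 0%N => forall x, D x -> {for x, continuous f}
  | k'.+1 => (forall x, D x -> differentiable f x) /\
             forall v : V, is_Ck k' D (fun x => 'D_v f x)
  end.

(* An atlas of a smooth manifold without boundary. The Hausdorff property comes
   with the metric of M. The values of [cmap i] outside [cdom i] and of [cinv i]
   outside the chart image are irrelevant. *)
Record smooth_atlas (R : realType) (M : metricType R) (n : nat) := SmoothAtlas {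
  chart : Type ;
  cdom : chart -> set M ;
  cmap : chart -> M -> 'rV[R]_n ;
  cinv : chart -> 'rV[R]_n -> M ;
  atlas_countable : @second_countable M ;
  cdom_open : forall i, open (cdom i) ;
  cdom_cover : forall x, exists i, cdom i x ;
  cimg_open : forall i, open (cmap i @` cdom i) ;
  cmapK : forall i x, cdom i x -> cinv i (cmap i x) = x ;
  cmap_continuous : forall i x, cdom i x -> {for x, continuous (cmap i)} ;
  cinv_continuous : forall i y, (cmap i @` cdom i) y ->
    {for y, continuous (cinv i)} ;
  transition_smooth : forall i j k,
    is_Ck k (cmap i @` (cdom i `&` cdom j)) (cmap j \o cinv i)
}.

(* T_x M: a tangent vector is given by its components in every chart around x,
   related by the derivatives of the transition maps. Components in charts whose
   domain does not contain x carry no information and are never used. *)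
Record tangent (R : realType) (M : metricType R) (n : nat)
    (A : smooth_atlas M n) (x : M) := Tangent {
  tcoord :> chart A -> 'rV[R]_n ;
  tcoord_change : forall i j, cdom i x -> cdom j x ->
    tcoord j = 'd (cmap j \o cinv i) (cmap i x) (tcoord i)
}.

Definition vector_field_family (R : realType) (M : metricType R) (n m : nat)
    (A : smooth_atlas M n) :=
  forall x : M, 'rV[R]_m -> tangent A x.

Definition is_C1_family (R : realType) (M : metricType R) (n m : nat)
    (A : smooth_atlas M n) (F : vector_field_family m A) : Prop :=
  forall i : chart A,
    is_Ck 1 [set p : 'rV[R]_n * 'rV[R]_m | (cmap i @` cdom i) p.1]
      (fun p => F (cinv i p.1) p.2 i).

Section ControlSystem.
Context {R : realType} {M : metricType R} {n m : nat}.
Variables (A : smooth_atlas M n) (F : vector_field_family m A).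

Notation mu := (@lebesgue_measure R).

(* Measurability of w : R -> R^m (Borel) is tested coordinatewise. *)
Definition control (V : set 'rV[R]_m) : set (R -> 'rV[R]_m) :=
  [set w | (forall t, V (w t)) /\
           forall j, measurable_fun [set: R] (fun t : R => w t ord0 j)].

(* Caratheodory solution of x' = F(x, w) on [0, +oo[ : a continuous curve that
   satisfies the integrated equation as long as it stays in a chart. *)
Definition solution (w : R -> 'rV[R]_m) (x0 : M) (xi : R -> M) : Prop :=
  [/\ xi 0 = x0,
      {within `[0, +oo[, continuous xi} &
      forall (i : chart A) (s t : R), 0 <= s -> s <= t ->
        (forall r, s <= r <= t -> cdom i (xi r)) ->
        forall k, cmap i (xi t) ord0 k - cmap i (xi s) ord0 k =
          \int[mu]_(r in `[s, t]) F (xi r) (w r) i ord0 k].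

Definition solution_map (V : set 'rV[R]_m)
    (phi : R -> M -> (R -> 'rV[R]_m) -> M) : Prop :=
  forall x w, control V w ->
    solution w x (fun t => phi t x w) /\
    forall xi, solution w x xi -> forall t, 0 <= t -> xi t = phi t x w.

End ControlSystem.

Section Invariance.
Context {R : realType} {M : metricType R} {m : nat}.
Variable phi : R -> M -> (R -> 'rV[R]_m) -> M.
Implicit Types (V : set 'rV[R]_m) (K Q D : set M).

Notation mu := (@lebesgue_measure R).

Definition reach V (x : M) : set M :=
  [set y | exists t w, [/\ 0 < t, control V w & phi t x w = y]].

Definition controlled_invariant V Q : Prop :=
  forall x, Q x ->
    exists2 w, control V w & forall t, 0 <= t -> Q (phi t x w).

Definition approx_controllable V D : Prop :=
  controlled_invariant V D /\ forall x, D x -> D `<=` closure (reach V x).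

Definition control_set V D : Prop :=
  approx_controllable V D /\
  forall D', approx_controllable V D' -> D `<=` D' -> D' = D.

(* D is an inner control set of the system with control range U, witnessed by
   the family UU of control ranges. In the last condition rho = 0 has to be
   excluded: since DD 0 = D the condition would be void otherwise. *)
Definition inner_control_set (U : set 'rV[R]_m) D
    (UU : R -> set 'rV[R]_m) : Prop :=
  [/\ control_set U D,
      forall rho, 0 <= rho <= 1 ->
        compact (UU rho) /\ @convex_set R 'rV[R]_m (UU rho),
      forall rho1 rho2, 0 <= rho1 -> rho1 < rho2 -> rho2 <= 1 ->
        UU rho1 `<=` UU rho2 &
      exists DD : R -> set M,
        [/\ forall rho, 0 <= rho <= 1 ->
              [/\ control_set (UU rho) (DD rho),
                  (DD rho)° !=set0 & compact (closure (DD rho))],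
            U = UU 0 /\ D = DD 0,
            forall rho1 rho2, 0 <= rho1 -> rho1 < rho2 -> rho2 <= 1 ->
              closure (DD rho1) `<=` (DD rho2)° &
            forall W : set M, set_nbhs (closure D) W ->
              exists2 rho, 0 < rho < 1 & closure (DD rho) `<=` W]].

Definition admissible V K Q : Prop :=
  [/\ K !=set0, Q !=set0, compact K &
      forall x, K x -> exists2 w, control V w &
        forall t, 0 <= t -> Q (phi t x w)].

Definition spanning V (tau : R) K Q (S : set (R -> 'rV[R]_m)) : Prop :=
  S `<=` control V /\
  forall x, K x -> exists2 w, S w &
    forall t, 0 <= t <= tau -> Q (phi t x w).

Definition action (f : 'rV[R]_m -> R) (tau : R) (w : R -> 'rV[R]_m) : R :=
  \int[mu]_(t in `[0, tau]) f (w t).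

(* This is a_tau(f, K, Q); it is +oo when there is no spanning set. *)
Definition inv_sum V (f : 'rV[R]_m -> R) (tau : R) K Q : \bar R :=
  ereal_inf [set \esum_(w in S) (expR (action f tau w))%:E
            | S in spanning V tau K Q].

Definition inv_rate V f K Q (tau : R) : \bar R :=
  ((tau^-1)%:E * lne (inv_sum V f tau K Q))%E.

Definition inv_pressure V f K Q : \bar R :=
  limf_esup (inv_rate V f K Q) +oo.

Definition eps_nbhd (eps : R) Q : set M :=
  [set y | exists2 x, Q x & mdist x y < eps].

Definition outer_pressure V f K Q : \bar R :=
  lim (inv_pressure V f K (eps_nbhd eps Q) @[eps --> 0^'+]).

End Invariance.

(* Main.v *)
(* Let N_d denote the d-neighbourhood of Q = cl D and a_t(S) the quantity
   a_t(f, K, S). For e > 0 pick rho with cl D_rho in N_e(Q) and d with N_d(Q) in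
   E = cl D_(rho/2), a compact subset of D_rho. Trajectories joining two points
   of a control set stay in it, so every point of E can be steered into int K
   inside D_rho, and by continuous dependence and compactness finitely many
   controls suffice. Inserting them between the members of spanning sets gives
   a_(s+t)(N_e) <= B a_s(N_d) a_t(N_e) with B independent of s and t; iterating
   in t, the limsup for N_e is at most (log B + log a_s(N_d)) / s for every s,
   hence at most the liminf for N_d. *)
Require Import Defs.
From HB Require Import structures.
From mathcomp Require Import all_boot all_order all_algebra.
From mathcomp Require Import all_classical all_reals all_analysis.
From mathcomp Require Import measurable_realfun.
From mathcomp Require Import lra ring.

Set Implicit Arguments.
Unset Strict Implicit.
Unset Printing Implicit Defensive.

Import Order.TTheory GRing.Theory Num.Theory.
Import numFieldNormedType.Exports.

Local Open Scope classical_set_scope.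
Local Open Scope ring_scope.

(** * Measurability and integrals *)

(** The solution map is given only by existence and uniqueness, so continuous dependence on the
    initial point has to be derived: charts give Lipschitz estimates over short times, and an
    induction over real time carries continuity along a whole trajectory, which may cross many
    charts. The control stays fixed throughout, so no topology on controls is involved.

    While steering, a trajectory may leave [N_d]; it is confined only to [D_rho], hence to [N_e].
    The inequality therefore links two different neighbourhoods, and equality appears only in the
    limit. Two indices occur because [D_rho] need not be compact, while finitely many steering
    controls suffice only for a compact set of starting points inside [D_rho].

    The inserted pieces prolong the controls beyond time [s + t]. The excess is cut off, and since
    [f] is bounded on [U_1] this changes the action by a bounded amount. Horizons thus add exactly,
    and no steering times of varying length enter the iteration. *)

Lemma compact_finite_choice (X : topologicalType) (I : eqType) (K : set X)
    (P : I -> X -> Prop) : compact K ->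
  (forall x, K x -> exists i, \forall x' \near x, P i x') ->
  exists l : seq I, forall x, K x -> exists2 i, i \in l & P i x.
Proof.
move=> /compact_near_coveringP cK KP.
(* Finite lists ordered by inclusion form a directed set, and [F] is the filter of its final
   segments. Having a working index in the list is then an eventual property, to which the
   near-covering form of compactness applies. *)
pose F : set_system (seq I) :=
  [set S | exists l : seq I, forall l' : seq I, {subset l <= l'} -> S l'].
have FF : Filter F.
  apply: Build_Filter.
  - by exists [::].
  - move=> A B [la Ala] [lb Blb]; exists (la ++ lb) => l' sl'; split.
      by apply: Ala => i il; apply: sl'; rewrite mem_cat il.
    by apply: Blb => i il; apply: sl'; rewrite mem_cat il orbT.
  - by move=> A B AB [l Al]; exists l => l' /Al /AB.
have [x Kx|l Pl] := cK _ F (fun (l : seq I) x => exists2 i, i \in l & P i x) FF.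
  have [i Pi] := KP _ Kx.
  exists (P i, [set l0 : seq I | i \in l0]).
    by split => //; exists [:: i] => l' /(_ i); apply; rewrite inE.
  by move=> [x' l] /= [Pix' il]; exists i.
by exists l => x Kx; exact: (Pl l _ x Kx).
Qed.

Section Measurability.
Variable R : realType.

(** The set where [c < g \o p] is a countable union of preimages of those balls, with dense centres
    and radii [1 / (k + 1)], on which [g] exceeds [c] within [E]. So [p] has to be tested on balls
    only. *)
Lemma measurable_comp_dense (T : pseudoMetricType R) (I : countType)
    (d : I -> T) (D : set R) (p : R -> T) (E : set T) (g : T -> R) :
  (forall (x : T) (e : R), 0 < e -> exists i, ball x e (d i)) ->
  measurable D ->
  (forall i e, measurable (D `&` [set t | ball (d i) e (p t)])) ->
  (forall t, D t -> E (p t)) ->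
  (forall x, E x -> g @ within E (nbhs x) --> g x) ->
  measurable_fun D (g \o p).
Proof.
move=> dd mD mp DE cg.
apply: (measurability _ (RGenOInfty.measurableE R)) => _ [_ [c ->] <-].
pose good (i : I * nat) :=
  forall x, E x -> ball (d i.1) i.2.+1%:R^-1 x -> c < g x.
pose S (i : I * nat) : set R :=
  if `[< good i >] then D `&` [set t | ball (d i.1) i.2.+1%:R^-1 (p t)]
  else set0.
suff -> : D `&` (g \o p) @^-1` `]c, +oo[ = \bigcup_i S i.
  apply: countable_bigcupT_measurable => // i.
  by rewrite /S; case: ifP.
apply/seteqP; split => [t /= [Dt]|t [i _]]; last first.
  rewrite /S; case: asboolP => // gi [Dt /= pt]; split => //=.
  by rewrite in_itv/= andbT; apply: gi => //; exact: DE.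
rewrite in_itv/= andbT => cgt.
have : \forall x \near within E (nbhs (p t)), c < g x.
  have := cg _ (DE t Dt) [set y | c < y]; apply.
  exact: lt_nbhsr.
rewrite near_withinE => /nbhs_ballP[e /= e0 eE].
have [k ke] : exists k : nat, k.+1%:R^-1 < e / 2.
  have e20 : 0 < e / 2 by rewrite divr_gt0.
  by have := @near_infty_natSinv_lt R (PosNum e20) => -[k _ /(_ k)/= h]; exists k; exact: h.
have k0 : (0 : R) < k.+1%:R^-1 by rewrite invr_gt0.
have [i pti] := dd (p t) _ k0.
exists (i, k) => //; rewrite /S; case: asboolP => [_|[]]; last first.
  move=> x Ex dx; apply: eE => //=.
  apply: (@le_ball _ _ _ (k.+1%:R^-1 + k.+1%:R^-1)).
    by rewrite (splitr e) lerD// ltW.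
  exact: ball_triangle pti dx.
by split => //=; exact: ball_sym.
Qed.

Definition ratrV N (q : 'rV[rat]_N) : 'rV[R]_N := map_mx ratr q.

Lemma ratrV_dense N (x : 'rV[R]_N) (e : R) : 0 < e ->
  exists q, ball x e (ratrV q).
Proof.
move=> e0.
have /choice[q qP] : forall j, exists q : rat, ball (x ord0 j) e (ratr q).
  move=> j; have [q] := @rat_in_itvoo R (x ord0 j) (x ord0 j + e) ltac:(lra).
  rewrite in_itv/= => /andP[h1 h2]; exists q.
  by rewrite /ball/= ltr_norml; apply/andP; split; lra.
exists (\row_j q j); split => // i j; rewrite !mxE ord1.
exact: qP.
Qed.

Lemma measurable_rV_ball N (D : set R) (p : R -> 'rV[R]_N) (c : 'rV[R]_N) (e : R) :
  measurable D -> (forall j, measurable_fun D (fun t => p t ord0 j)) ->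
  measurable (D `&` [set t | ball c e (p t)]).
Proof.
(* For [e <= 0] the ball is empty by definition; the intersection over coordinates would miss this
   when [N = 0]. *)
move=> mD mp; have [e0|e0] := ltP 0 e; last first.
  rewrite (_ : _ `&` _ = set0) -?subset0// => t [_ [h _]].
  by move: h; rewrite ltNge e0.
rewrite (_ : _ `&` _ = D `&` \bigcap_(j : 'I_N)
    (D `&` (fun t => p t ord0 j) @^-1` ball (c ord0 j) e)).
  apply: measurableI => //; apply: fin_bigcap_measurable => // j _.
  by apply: mp => //; exact: measurable_ball.
apply/seteqP; split => t [Dt].
  by move=> [_ h]; split => // j _; split => //; exact: h.
by move=> h; split => //; split => // i j; rewrite ord1; have [] := h j Logic.I.
Qed.

Lemma measurable_comp_rV N (D : set R) (p : R -> 'rV[R]_N) (E : set 'rV[R]_N)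
    (g : 'rV[R]_N -> R) :
  measurable D -> (forall j, measurable_fun D (fun t => p t ord0 j)) ->
  (forall t, D t -> E (p t)) -> {within E, continuous g} ->
  measurable_fun D (g \o p).
Proof.
move=> mD mp DE /subspace_continuousP cg.
apply: (@measurable_comp_dense _ _ (@ratrV N) D p E) => //.
  exact: ratrV_dense.
by move=> i e; exact: measurable_rV_ball.
Qed.

Lemma measurable_comp_rV2 n m (D : set R) (p : R -> 'rV[R]_n)
    (q : R -> 'rV[R]_m) (E : set ('rV[R]_n * 'rV[R]_m))
    (g : 'rV[R]_n * 'rV[R]_m -> R) :
  measurable D -> (forall j, measurable_fun D (fun t => p t ord0 j)) ->
  (forall j, measurable_fun D (fun t => q t ord0 j)) ->
  (forall t, D t -> E (p t, q t)) -> 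
  (forall x, E x -> {for x, continuous g}) ->
  measurable_fun D (fun t => g (p t, q t)).
Proof.
move=> mD mp mq DE cg.
apply: (@measurable_comp_dense _ _
    (fun k : 'rV[rat]_n * 'rV[rat]_m => (ratrV k.1, ratrV k.2)) D
    (fun t => (p t, q t)) E g) => //.
- move=> [x y] e e0; have [k1 h1] := ratrV_dense x e0.
  by have [k2 h2] := ratrV_dense y e0; exists (k1, k2).
- move=> [k1 k2] e.
  rewrite (_ : _ `&` _ = (D `&` [set t | ball (ratrV k1) e (p t)]) `&`
     (D `&` [set t | ball (ratrV k2) e (q t)])).
    by apply: measurableI; exact: measurable_rV_ball.
  apply/seteqP; split => [t [Dt [/= h1 h2]]|t [[Dt h1] [_ h2]]] //.
- by move=> x Ex; apply: cvg_within_filter; exact: cg.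
Qed.

End Measurability.

(** * Integrals over intervals: bounds, splitting and translation *)

Section Integrals.
Variable R : realType.
Notation mu := (@lebesgue_measure R).
Implicit Types (f g : R -> R) (s t c : R).

Lemma integrable_itv_bounded f C s t :
  measurable_fun `[s, t] f -> (forall r, s <= r <= t -> `|f r| <= C) ->
  mu.-integrable `[s, t] (EFin \o f).
Proof.
move=> mf fC; apply: measurable_bounded_integrable => //.
  rewrite /= lebesgue_measure_itv/=; case: ifP => _ //.
  by rewrite -EFinD ltry.
exists C; split; rewrite ?num_real// => x Cx y /=; rewrite in_itv/= => yst.
by rewrite (le_trans (fC _ yst))// ltW.
Qed.

Lemma normr_Rintegral_itv_le f C s t : s <= t -> 0 <= C ->
  measurable_fun `[s, t] f -> (forall r, s <= r <= t -> `|f r| <= C) ->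
  `|\int[mu]_(r in `[s, t]) f r| <= C * (t - s).
Proof.
move=> st C0 mf fC.
have If := integrable_itv_bounded mf fC.
apply: (le_trans (le_normr_Rintegral _ If)) => //.
have -> : C * (t - s) = \int[mu]_(r in `[s, t]) C.
  rewrite Rintegral_cst// /= lebesgue_measure_itv/= lte_fin.
  by case: ltgtP st => [|//|->] //=; rewrite subrr.
apply: le_Rintegral => //.
- apply: (integrable_itv_bounded (C := C)).
    exact: measurableT_comp.
  by move=> r rst; rewrite normr_id fC.
- apply: (integrable_itv_bounded (C := C)) => //.
  by move=> r rst; rewrite ger0_norm.
Qed.

Lemma Rintegral_itv_split f s c t : s <= c -> c <= t ->
  mu.-integrable `[s, t] (EFin \o f) ->
  \int[mu]_(r in `[s, t]) f r =
  \int[mu]_(r in `[s, c]) f r + \int[mu]_(r in `[c, t]) f r.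
Proof.
move=> sc ct If.
have := @Rintegral_itvB R f (BLeft s) (BRight t) c If.
rewrite !bnd_simp => /(_ sc ct).
have -> : \int[mu]_(x in `]c, t]) f x = \int[mu]_(x in `[c, t]) f x.
  apply: Rintegral_itv_obnd_cbnd; apply: integrableS If => // r /=.
  by rewrite !in_itv/= => /andP[h ->]; rewrite andbT (le_trans sc)// ltW.
by move=> <-; rewrite addrC subrK.
Qed.

(** By uniqueness of the measure with prescribed values on half-open intervals. *)
Lemma lebesgue_measure_shift c (X : set R) : measurable X ->
  pushforward mu (fun r : R => r - c) X = mu X.
Proof.
have mS : measurable_fun [set: measurableTypeR R]
    (fun r : measurableTypeR R => r - c : measurableTypeR R).
  exact: measurable_funB.
move=> mX.
pose nu : {measure set (measurableTypeR R) -> \bar R} :=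
   pushforward mu (fun r : measurableTypeR R => (r - c : measurableTypeR R)).
rewrite -[LHS]/(nu mS X); apply/esym; apply: lebesgue_measure_unique => // _ [[a b] _ <-].
rewrite /nu/= /pushforward.
have -> : (fun r : R => r - c) @^-1` `]a, b] = `]a + c, b + c]%classic.
  by apply/seteqP; split => r /=; rewrite !in_itv/= ltrBrDr lerBlDr.
rewrite !lebesgue_measure_itv/= !lte_fin ltrD2r; case: ifP => // _.
by rewrite -!EFinB; congr EFin; ring.
Qed.

Lemma Rintegral_itv_shift f C c s t :
  measurable_fun `[s, t] f -> (forall r, s <= r <= t -> `|f r| <= C) ->
  \int[mu]_(r in `[s + c, t + c]) f (r - c) = \int[mu]_(r in `[s, t]) f r.
Proof.
(* Change of variables by pushforward wants a function measurable on the whole line, hence the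
   extension [g] of [f]. *)
move=> mf fC; pose g := f \_ `[s, t].
have fg r : s <= r <= t -> g r = f r.
  by move=> rst; rewrite /g patchE mem_set//= in_itv.
have mg : measurable_fun [set: R] g by apply/(measurable_restrictT f).
transitivity (\int[mu]_(r in `[s + c, t + c]) g (r - c)).
  apply: eq_Rintegral => r; rewrite inE/= in_itv/= => /andP[h1 h2].
  by rewrite fg// lerBrDr lerBlDr h1 h2.
transitivity (\int[mu]_(r in `[s, t]) g r); last first.
  by apply: eq_Rintegral => r; rewrite inE/= in_itv/= => h; rewrite fg.
have mS : measurable_fun [set: measurableTypeR R]
    (fun r : measurableTypeR R => r - c : measurableTypeR R).
  exact: measurable_funB.
have E : (fun r : R => r - c) @^-1` `[s, t] = `[s + c, t + c]%classic.
  by apply/seteqP; split => r /=; rewrite !in_itv/= lerBrDr lerBlDr.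
rewrite /Rintegral; congr fine.
have := @integral_pushforward _ _ _ _ R _ mS mu `[s, t]%classic (EFin \o g).
rewrite E => <- //.
- by apply: eq_measure_integral => X mX _; exact: lebesgue_measure_shift.
- exact/measurable_EFinP.
- apply: (@integrable_itv_bounded (fun r => g (r - c)) C).
    by apply: measurable_funTS; exact: measurableT_comp.
  by move=> r /andP[h1 h2]; rewrite fg ?fC// lerBrDr lerBlDr h1 h2.
Qed.

(** The left end point is left out because at the switching time [concat] still takes the value of
    the first control. *)
Lemma eq_Rintegral_itv_oc f g s t :
  mu.-integrable `[s, t] (EFin \o f) -> mu.-integrable `[s, t] (EFin \o g) ->
  (forall r, s < r <= t -> f r = g r) ->
  \int[mu]_(r in `[s, t]) f r = \int[mu]_(r in `[s, t]) g r.
Proof.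
move=> If Ig fg.
have I' h : mu.-integrable `[s, t] (EFin \o h) ->
    mu.-integrable `]s, t] (EFin \o h).
  apply: integrableS => // r /=.
  by rewrite !in_itv/= => /andP[h1 ->]; rewrite andbT ltW.
rewrite -!Rintegral_itv_obnd_cbnd; [|exact: I'..].
by apply: eq_Rintegral => r; rewrite inE/= in_itv/=; exact: fg.
Qed.

End Integrals.

(** * Local Lipschitz bounds *)

(** Pairing the neighbourhoods of [x0] with those of +oo lets compactness of [V] select a
    neighbourhood of [x0] and a bound at the same time. *)
Lemma compact_tube_bound (R : realType) (X Y : topologicalType)
    (W : normedModType R) (g : X * Y -> W) (x0 : X) (V : set Y) :
  compact V -> (forall u, V u -> {for (x0, u), continuous g}) ->
  exists2 C : R, 0 <= C & \forall x \near x0, forall u, V u -> `|g (x, u)| <= C.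
Proof.
move=> /compact_near_coveringP cV cg.
have FF : Filter (filter_prod (nbhs x0) (pinfty_nbhs R)) by apply: filter_prod_filter.
have H := cV _ _ (fun (i : X * R) u => `|g (i.1, u)| <= i.2) FF.
case: H => [u Vu|].
  have := cg u Vu => /cvgr_norm_lt /(_ (`|g (x0, u)| + 1)).
  rewrite ltrDl ltr01 => /(_ isT)[[Q1 Q2]] /= [q1 q2] Q.
  exists (Q2, (Q1 `*` [set C | `|g (x0, u)| + 1 <= C])).
    split => //; exists (Q1, [set C | `|g (x0, u)| + 1 <= C]) => //=.
    split => //; apply: nbhs_pinfty_ge; exact: num_real.
  move=> [u' [x C]] [/= h1 [/= h2 h3]].
  by rewrite (le_trans _ h3)// ltW//; apply: (Q (x, u')).
move=> [Q1 Q2] /= [q1 [C0 [_ q2]]] Q.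
exists (Num.max 0 C0 + 1).
  by rewrite addr_ge0// le_max lexx.
apply: filterS q1 => x Q1x u Vu.
apply: (Q (x, _) _ u Vu); split => //=; apply: q2.
by rewrite (le_lt_trans (y := Num.max 0 C0))// ?ltrDl// le_max lexx orbT.
Qed.

Lemma norm_coord_le (R : realType) N (x : 'rV[R]_N) k : `|x ord0 k| <= `|x|.
Proof.
rewrite [leRHS]/Num.norm/= mx_normrE.
by apply/bigmax_geP; right => /=; exists (ord0, k).
Qed.

Lemma norm_rV_le (R : realType) N (x : 'rV[R]_N) (C : R) : 0 <= C ->
  (forall k, `|x ord0 k| <= C) -> `|x| <= C.
Proof.
move=> C0 xC; rewrite [leLHS]/Num.norm/= mx_normrE.
apply/bigmax_leP; split => // -[i j] _ /=.
by rewrite ord1; exact: xC.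
Qed.

Section LipschitzFamily.
Variables (R : realType) (n m : nat).

(** The partial derivatives in the state variable are bounded near [x0] uniformly over the compact
    [V]. The mean value theorem along the segment from [y] to [x], applied to each component, gives
    the sum of these bounds as Lipschitz constant for the sup norm. *)
Lemma locally_lipschitz_rV (N : nat) (O : set 'rV[R]_n) (V : set 'rV[R]_m)
    (G : 'rV[R]_n * 'rV[R]_m -> 'rV[R]_N) (x0 : 'rV[R]_n) :
  open O -> O x0 -> compact V ->
  is_Ck 1 [set p : 'rV[R]_n * 'rV[R]_m | O p.1] G ->
  exists r C L : R, [/\ 0 < r, 0 <= C /\ 0 <= L,
    forall x, `|x - x0| <= r -> O x,
    forall x u, `|x - x0| <= r -> V u -> `|G (x, u)| <= C &
    forall x y u k, `|x - x0| <= r -> `|y - x0| <= r -> V u ->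
      `|G (x, u) ord0 k - G (y, u) ord0 k| <= L * `|x - y| ].
Proof.
move=> oO Ox0 cV [dG cG].
have [C C0 nC] := compact_tube_bound cV (fun u Vu =>
   differentiable_continuous (dG (x0, u) Ox0)).
pose e j : 'rV[R]_n * 'rV[R]_m := (delta_mx 0 j, 0).
have /choice[c cP] : forall j : 'I_n, exists c : R, 0 <= c /\
    \forall x \near x0, forall u, V u -> `|'D_(e j) G (x, u)| <= c.
  move=> j; have [c c0 h] := @compact_tube_bound R _ _ _ ('D_(e j) G) x0 V cV
    (fun u Vu => cG (e j) (x0, u) Ox0).
  by exists c.
have : \forall x \near x0, [/\ O x, forall u, V u -> `|G (x, u)| <= C &
   forall j u, V u -> `|'D_(e j) G (x, u)| <= c j].
  have h1 : \forall x \near x0, O x by apply: open_nbhs_nbhs.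
  have h2 : \forall x \near x0, forall j u, V u -> `|'D_(e j) G (x, u)| <= c j.
    apply: (@filter_forall _ _
      (fun j x => forall u, V u -> `|'D_(e j) G (x, u)| <= c j) _ (nbhs_filter x0)).
    by move=> j; have [] := cP j.
  by near=> x; split; [near: x..].
move=> /nbhs_ballP[r0 /= r00 H].
pose r := r0 / 2; have r_0 : 0 < r by rewrite divr_gt0.
have {}H x : `|x - x0| <= r -> [/\ O x, forall u, V u -> `|G (x, u)| <= C &
   forall j u, V u -> `|'D_(e j) G (x, u)| <= c j].
  move=> xr; apply: H; rewrite -ball_normE/= distrC (le_lt_trans xr)//.
  by rewrite /r ltr_pdivrMr// ltr_pMr// ltr1n.
exists r, C, (\sum_j c j); split => //.
- by split => //; apply: sumr_ge0 => j _; have [] := cP j.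
- by move=> x /H[].
- by move=> x u /H[_ + _]; apply.
move=> x y u k xr yr Vu.
pose w : 'rV[R]_n * 'rV[R]_m := (x - y, 0).
have wE : w = \sum_j (x - y) ord0 j *: e j.
  rewrite /w {1}[x - y]row_sum_delta.
  elim/big_rec2 : _ => // j v1 v2 _ <-.
  by rewrite /e; congr pair; rewrite /= ?scaler0 ?addr0.
pose l (s : R) : 'rV[R]_n * 'rV[R]_m := s *: w + (y, u).
have l1 (s : R) : 0 <= s <= 1 -> `|(l s).1 - x0| <= r.
  move=> /andP[s0 s1].
  rewrite (_ : _ - x0 = s *: (x - x0) + (1 - s) *: (y - x0)).
    apply: (le_trans (ler_normD _ _)).
    rewrite !normrZ (ger0_norm s0) ger0_norm ?subr_ge0//.
    have h1 := ler_wpM2l s0 xr.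
    have h2 : (1 - s) * `|y - x0| <= (1 - s) * r by rewrite ler_wpM2l ?subr_ge0.
    lra.
  by apply/rowP => j; rewrite !mxE; ring.
have l2 s : (l s).2 = u by rewrite /l/= scaler0 add0r.
have dl (s : R) : 0 <= s <= 1 ->
    is_derive s 1 (fun s : R => G (l s) ord0 k) ('D_w G (l s) ord0 k).
  move=> s01.
  have dGs : differentiable G (l s) by apply: dG; have [] := H _ (l1 _ s01).
  have Q : h^-1 *: (((fun s : R => G (l s) ord0 k) \o shift s) (h *: 1) - G (l s) ord0 k)
      @[h --> (0 : R)^'] --> 'D_w G (l s) ord0 k.
    have /= := @diff_derivable _ _ _ G (l s) w dGs.
    move/cvgP => /(cvg_comp _ _)/(_ (@coord_continuous R 1 _ ord0 k _)).
    apply: cvg_trans; apply: near_eq_cvg; near=> h => /=.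
    rewrite !mxE; congr (_ * (G _ _ _ - _)).
    by rewrite /l/= [h *: 1]mulr1 scalerDl addrA.
  by apply: DeriveDef; [exact: cvgP Q|exact: cvg_lim Q].
have l1E : l 1 = (x, u) by rewrite /l/w scale1r; congr pair; rewrite /= ?subrK ?add0r.
have l0E : l 0 = (y, u) by rewrite /l scale0r add0r.
have [s s01] : exists2 s, s \in `[0, 1]%R &
    G (l 1) ord0 k - G (l 0) ord0 k = 'D_w G (l s) ord0 k * (1 - 0).
  apply: (@MVT_segment R (fun s => G (l s) ord0 k)) => //.
    by move=> s; rewrite in_itv/= => /andP[s0 s1]; apply: dl; rewrite !ltW.
  apply: derivable_within_continuous => s; rewrite in_itv/= => /dl[].
  by [].
rewrite l1E l0E subr0 mulr1 => ->.
rewrite in_itv/= in s01.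
have [Ols _ Ds] := H _ (l1 _ s01).
have dGs : differentiable G (l s) by apply: dG.
rewrite deriveE// wE linear_sum/= summxE.
apply: (le_trans (ler_norm_sum _ _ _)); rewrite mulr_suml; apply: ler_sum => j _.
rewrite linearZ/= mxE normrM mulrC ler_pM//; last exact: norm_coord_le.
apply: (le_trans (norm_coord_le _ _)); rewrite -deriveE//.
have -> : l s = ((l s).1, u) by rewrite -(l2 s); case: (l s).
exact: Ds.
Unshelve. all: by end_near. Qed.

End LipschitzFamily.

(** * Concatenation of controls *)

Definition concat (R : realType) (X : Type) (T : R) (w w' : R -> X) : R -> X :=
  fun t => if t <= T then w t else w' (t - T).

Lemma within_eq_continuous (T U : topologicalType) (X : set T) (f g : T -> U) :
  (forall x, X x -> f x = g x) -> {within X, continuous f} ->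
  {within X, continuous g}.
Proof.
move=> fg /subspace_continuousP cf; apply/subspace_continuousP => x Xx.
have cfx : f @ within X (nbhs x) --> g x by rewrite -(fg x Xx); exact: cf.
apply: cvg_trans cfx; apply: near_eq_cvg.
by rewrite near_withinE; near=> y => Xy; rewrite fg.
Unshelve. all: by end_near. Qed.

Section Trajectories.
Context {R : realType} {M : metricType R} {n m : nat}.
Variables (A : smooth_atlas M n) (F : vector_field_family m A).
Hypothesis hF : is_C1_family F.
Variable V : set 'rV[R]_m.
Hypothesis cV : compact V.
Notation mu := (@lebesgue_measure R).

Let G i (p : 'rV[R]_n * 'rV[R]_m) : 'rV[R]_n := F (cinv i p.1) p.2 i.

Lemma F_chartE i x u : cdom i x -> F x u i = G i (cmap i x, u).
Proof. by move=> ix; rewrite /G/= cmapK. Qed.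

Lemma control_concat T w w' : control V w -> control V w' ->
  control V (concat T w w').
Proof.
move=> [Vw mw] [Vw' mw']; split.
  by move=> t; rewrite /concat; case: ifP.
move=> j.
have -> : (fun t => concat T w w' t ord0 j) =
    (fun t => if t <= T then w t ord0 j else w' (t - T) ord0 j).
  by apply/funext => t; rewrite /concat; case: ifP.
apply: measurable_fun_ifT => //.
- apply: measurable_fun_ler => //.
- apply: (measurableT_comp (mw' j)).
  exact: measurable_funB.
Qed.

Lemma control_shift T w : control V w -> control V (fun t => w (t + T)).
Proof.
move=> [Vw mw]; split => // j.
apply: (measurableT_comp (mw j)).
exact: measurable_funD.
Qed.

Lemma concat_shift (X : Type) T (w : R -> X) : concat T w (fun t => w (t + T)) = w.
Proof. by apply/funext => t; rewrite /concat subrK; case: ifP. Qed.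

Lemma within_itvcy_sub (xi : R -> M) s t : 0 <= s ->
  {within `[0, +oo[, continuous xi} -> {within `[s, t], continuous xi}.
Proof.
move=> s0; apply: continuous_subspaceW => r /=.
by rewrite !in_itv/= andbT => /andP[h _]; exact: le_trans s0 h.
Qed.

(** The integral in [solution] carries no integrability condition; these two facts supply it. In the
    chart the integrand is a continuous function of a continuous curve and a measurable control,
    with time in a compact interval and control values in the compact [V]. *)
Lemma integrand_measurable_bounded (xi : R -> M) w i s t k : 0 <= s ->
  {within `[0, +oo[, continuous xi} -> control V w ->
  (forall r, s <= r <= t -> cdom i (xi r)) ->
  exists C, measurable_fun `[s, t] (fun r => F (xi r) (w r) i ord0 k) /\
    forall r, s <= r <= t -> `|F (xi r) (w r) i ord0 k| <= C.
Proof.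
move=> s0 cxi [Vw mw] dxi.
have c_xi := @within_itvcy_sub xi s t s0 cxi.
have cu : {within `[s, t], continuous (cmap i \o xi)}.
  apply/subspace_continuousP => r rst; move/subspace_continuousP : c_xi => /(_ r rst) cr.
  apply: cvg_comp cr _; apply: cmap_continuous; apply: dxi.
  by move: rst; rewrite /= in_itv.
have [dG cG] := hF i.
have img r : s <= r <= t -> (cmap i @` cdom i) (cmap i (xi r)).
  by move=> /dxi h; exists (xi r).
have mF : measurable_fun `[s, t] (fun r => F (xi r) (w r) i ord0 k).
  apply: (@eq_measurable_fun _ _ _ _ _ (fun r => G i (cmap i (xi r), w r) ord0 k)).
    by move=> r; rewrite inE/= in_itv/= => rst; rewrite F_chartE//; exact: dxi.
  apply: (@measurable_comp_rV2 R n m `[s, t]%classic (cmap i \o xi) w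
    [set p | (cmap i @` cdom i) p.1] (fun p => G i p ord0 k)) => //.
  - move=> j; apply: subspace_continuous_measurable_fun => //.
    apply/subspace_continuousP => r rst; move/subspace_continuousP : cu => /(_ r rst) cr.
    exact: (cvg_comp _ _ cr (@coord_continuous R 1 n ord0 j _)).
  - by move=> j; exact: measurable_funTS.
  - move=> p pE.
    have cGp : G i x @[x --> p] --> G i p by apply: differentiable_continuous; exact: dG.
    exact: (cvg_comp _ _ cGp (@coord_continuous R 1 n ord0 k _)).
have [C HC] : exists C, forall r, s <= r <= t -> `|F (xi r) (w r) i ord0 k| <= C.
  have /compact_near_coveringP cst := @segment_compact R s t.
  have [|] := cst _ (pinfty_nbhs R)
    (fun C r => s <= r <= t -> `|F (xi r) (w r) i ord0 k| <= C) _.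
    move=> r /=; rewrite in_itv/= => rst.
    have [|C C0 nC] := @compact_tube_bound R _ _ _ (G i) (cmap i (xi r)) V cV.
      by move=> u _; apply: differentiable_continuous; apply: dG; exact: img.
    have : \forall r' \near within `[s, t] (nbhs r), forall u, V u ->
        `|G i (cmap i (xi r'), u)| <= C.
      move/subspace_continuousP : cu => /(_ r); rewrite /= in_itv/= => /(_ rst).
      by move=> /(_ _ nC).
    rewrite near_withinE => near_r.
    exists ([set x | `[s, t]%classic x -> forall u, V u -> `|G i (cmap i (xi x), u)| <= C],
            [set C' | C <= C']).
      by split => //; apply: nbhs_pinfty_ge; exact: num_real.
    move=> [r' C'] /= [h1 h2] r'st; rewrite F_chartE; last exact: dxi.
    apply: (le_trans (norm_coord_le _ _)); apply: le_trans h2; apply: h1 => //.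
  move=> C0 [_ HC]; exists (C0 + 1) => r rst; apply: HC => //.
  by rewrite ltrDl.
by exists C.
Qed.

Lemma integrand_integrable (xi : R -> M) w i s t k : 0 <= s ->
  {within `[0, +oo[, continuous xi} -> control V w ->
  (forall r, s <= r <= t -> cdom i (xi r)) ->
  mu.-integrable `[s, t] (EFin \o (fun r => F (xi r) (w r) i ord0 k)).
Proof.
move=> s0 cxi cw dxi; have [C [mF bF]] := integrand_measurable_bounded k s0 cxi cw dxi.
exact: integrable_itv_bounded bF.
Qed.

Lemma concat_continuous (xi yi : R -> M) T : 0 <= T ->
  {within `[0, +oo[, continuous xi} -> {within `[0, +oo[, continuous yi} ->
  yi 0 = xi T -> {within `[0, +oo[, continuous (concat T xi yi)}.
Proof.
move=> T0 cxi cyi yx.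
have -> : `[0, +oo[%classic = `[0, T]%classic `|` `[T, +oo[%classic.
  apply/seteqP; split => r /=; rewrite !in_itv/= ?andbT.
    by move=> r0; have [rT|/ltW rT] := lerP r T; [left; rewrite r0|right].
  by move=> [/andP[]//|]; exact: le_trans.
apply: withinU_continuous => //.
- exact: itv_closed.
- exact: rray_closed.
- apply: (@within_eq_continuous _ _ _ xi); last exact: within_itvcy_sub.
  by move=> r; rewrite /= in_itv/= => /andP[_ rT]; rewrite /concat rT.
- apply: (@within_eq_continuous _ _ _ (fun r => yi (r - T))).
    move=> r; rewrite /= in_itv/= andbT /concat => Tr.
    case: ifPn => // rT; have -> : r = T by apply/eqP; rewrite eq_le rT.
    by rewrite subrr.
  apply/subspace_continuousP => r /=; rewrite in_itv/= andbT => Tr.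
  have h : `[0, +oo[%classic (r - T) by rewrite /= in_itv/= andbT subr_ge0.
  move/subspace_continuousP : cyi => /(_ (r - T) h) cy.
  apply: cvg_comp cy => P; rewrite /= !/within/= => nP.
  have : \forall x \near r, `[0, +oo[%classic (x - T) -> P (x - T).
    have cB : (x - T) @[x --> r] --> r - T by apply: cvgB; [exact: cvg_id|exact: cvg_cst].
    exact: cB nP.
  apply: filterS => x xP /=; rewrite in_itv/= andbT => Tx; apply: xP.
  by rewrite /= in_itv/= andbT subr_ge0.
Qed.

(** An interval spent in a single chart may straddle [T]; it is then cut at [T], and each half stays
    in that chart. After [T] the equation for [yi] is translated in time. *)
Lemma solution_concat (xi yi : R -> M) w w' T x : 0 <= T ->
  control V w -> control V w' ->
  solution F w x xi -> solution F w' (xi T) yi ->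
  solution F (concat T w w') x (concat T xi yi).
Proof.
move=> T0 cw cw' [xi0 cxi sxi] [yi0 cyi syi].
have cc := concat_continuous T0 cxi cyi yi0.
have ccw := control_concat T cw cw'.
split => //; first by rewrite /concat T0.
have ca r : r <= T -> concat T xi yi r = xi r by rewrite /concat => ->.
have cb r : T <= r -> concat T xi yi r = yi (r - T).
  rewrite /concat => Tr; case: ifPn => // rT.
  have -> : r = T by apply/eqP; rewrite eq_le rT.
  by rewrite subrr yi0.
have before i s t : 0 <= s -> s <= t -> t <= T ->
    (forall r, s <= r <= t -> cdom i (concat T xi yi r)) -> forall k,
    cmap i (concat T xi yi t) ord0 k - cmap i (concat T xi yi s) ord0 k =
    \int[mu]_(r in `[s, t]) F (concat T xi yi r) (concat T w w' r) i ord0 k.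
  move=> s0 st tT di k; rewrite !ca ?(le_trans st)//.
  rewrite sxi// => [|r rst].
    apply: eq_Rintegral => r; rewrite inE/= in_itv/= => /andP[_ rt].
    by rewrite ca ?(le_trans rt)// /concat (le_trans rt).
  by have := di _ rst; rewrite ca// (le_trans _ tT)//; case/andP: rst.
have after i s t : T <= s -> s <= t ->
    (forall r, s <= r <= t -> cdom i (concat T xi yi r)) -> forall k,
    cmap i (concat T xi yi t) ord0 k - cmap i (concat T xi yi s) ord0 k =
    \int[mu]_(r in `[s, t]) F (concat T xi yi r) (concat T w w' r) i ord0 k.
  move=> Ts st di k; rewrite !cb ?(le_trans Ts)//.
  have di' r : s - T <= r <= t - T -> cdom i (yi r).
    move=> /andP[h1 h2]; have := di (r + T).
    rewrite cb ?addrK; last by lra.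
    by apply; lra.
  have sT0 : 0 <= s - T by rewrite subr_ge0.
  rewrite syi//; last by rewrite lerD2r.
  have [C [mF bF]] := integrand_measurable_bounded k sT0 cyi cw' di'.
  rewrite -(Rintegral_itv_shift T mF bF) !subrK.
  apply: eq_Rintegral_itv_oc.
  - apply: (@integrable_itv_bounded _ _ C).
      apply: (@measurable_comp _ _ _ _ _ _ `[s - T, t - T]%classic
        (fun r => F (yi r) (w' r) i ord0 k)) => //.
        by move=> _ [r /= + <-]; rewrite !in_itv/= !lerD2r.
      exact: measurable_funB.
    by move=> r /andP[h1 h2]; apply: bF; rewrite !lerD2r h1 h2.
  - exact: integrand_integrable (le_trans T0 Ts) cc ccw di.
  - move=> r /andP[h1 h2]; rewrite cb; last by lra.
    by rewrite /concat leNgt (le_lt_trans Ts h1).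
move=> i s t s0 st di k.
have [tT|Tt] := lerP t T; first exact: before.
have [Ts|sT] := lerP T s; first exact: after.
rewrite (@Rintegral_itv_split _ _ s T t) ?ltW//; last first.
  exact: integrand_integrable s0 cc ccw di.
rewrite -before// ?ltW//; last by move=> r /andP[h1 h2]; apply: di; rewrite h1 (le_trans h2)// ltW.
rewrite -after// ?ltW//; last by move=> r /andP[h1 h2]; apply: di; rewrite h2 (le_trans _ h1)// ltW.
by ring.
Qed.

End Trajectories.

(** * Local flow *)

(** The infimum of the failures cannot be a failure, by the first hypothesis, nor can failures
    accumulate at it from the right, by the second. *)
Lemma real_induction (R : realType) (P : R -> Prop) (T : R) :
  (forall t, 0 <= t <= T -> (forall s, 0 <= s < t -> P s) -> P t) ->
  (forall t, 0 <= t < T -> (forall s, 0 <= s <= t -> P s) ->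
    exists2 e, 0 < e & forall s, t < s < t + e -> P s) ->
  forall t, 0 <= t <= T -> P t.
Proof.
move=> closedP openP t0 t0T; apply: contrapT => nPt0.
pose B := [set t | 0 <= t <= T /\ ~ P t].
have hB : has_inf B.
  by split; [exists t0|exists 0 => t [/andP[]]].
pose b := inf B.
have b0 : 0 <= b by apply: lb_le_inf; [exists t0|move=> t [/andP[]]].
have bB t : B t -> b <= t by move=> Bt; apply: ge_inf => //; case: hB.
have bT : b <= T by rewrite (le_trans (bB _ (conj t0T nPt0)))//; case/andP: t0T.
have before s : 0 <= s < b -> P s.
  move=> /andP[s0 sb]; apply: contrapT => nPs.
  have : b <= s by apply: bB; split => //; rewrite s0 (le_trans (ltW sb)).
  by rewrite leNgt sb.
have Pb : P b by apply: closedP => //; rewrite b0.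
have before' s : 0 <= s <= b -> P s.
  move=> /andP[s0]; rewrite le_eqVlt => /predU1P[->//|sb].
  by apply: before; rewrite s0.
have {bT} : b < T.
  rewrite lt_neqAle bT andbT; apply/eqP => bE; apply: nPt0; apply: before'.
  by rewrite bE.
move=> bT; have [|e e0 he] := openP b _ before'; first by rewrite b0.
have [t Bt tb] := inf_adherent e0 hB.
case: (Bt) => _; apply.
have := bB _ Bt; rewrite le_eqVlt => /predU1P[<-//|bt].
by apply: he; rewrite bt.
Qed.

Section Flow.
Context {R : realType} {M : metricType R} {n m : nat}.
Variables (A : smooth_atlas M n) (F : vector_field_family m A).
Hypothesis hF : is_C1_family F.
Variable V : set 'rV[R]_m.
Hypothesis cV : compact V.
Variable phi : R -> M -> (R -> 'rV[R]_m) -> M.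
Hypothesis hphi : solution_map F V phi.
Notation mu := (@lebesgue_measure R).

(** The glued curve solves the equation for the glued control, so uniqueness identifies it with
    [phi]. *)
Lemma phi_concat T t x w w' : 0 <= T -> 0 <= t -> control V w -> control V w' ->
  phi t x (concat T w w') =
  concat T (fun r => phi r x w) (fun r => phi r (phi T x w) w') t.
Proof.
move=> T0 t0 cw cw'.
have [_ h] := hphi x (control_concat T cw cw').
apply/esym/h => //; apply: (solution_concat hF cV) => //.
  by case: (hphi x cw).
by case: (hphi (phi T x w) cw').
Qed.

Lemma phi0 x w : control V w -> phi 0 x w = x.
Proof. by move=> cw; have [[]] := hphi x cw. Qed.

Lemma phi_within x w : control V w ->
  {within `[0, +oo[, continuous (fun t => phi t x w)}.
Proof. by move=> cw; have [[]] := hphi x cw. Qed.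

Lemma phi_near x w t (O : set M) : control V w -> 0 <= t ->
  nbhs (phi t x w) O ->
  exists2 e, 0 < e & forall s, 0 <= s -> `|t - s| < e -> O (phi s x w).
Proof.
move=> cw t0 nO.
have /subspace_continuousP /(_ t) := phi_within (x := x) cw.
rewrite /= in_itv/= t0 => /(_ isT) /(_ _ nO).
move=> /nbhs_ballP[e /= e0 eO]; exists e => // s s0 ts.
by apply: eO => //=; rewrite in_itv/= s0.
Qed.

Lemma phi_shift s t x w : 0 <= s -> s <= t -> control V w ->
  phi t x w = phi (t - s) (phi s x w) (fun r => w (r + s)).
Proof.
move=> s0 st cw.
rewrite -{1}(concat_shift s w) phi_concat ?(le_trans s0)//; last exact: control_shift.
rewrite /concat; case: ifPn => // ts.
have -> : t = s by apply/eqP; rewrite eq_le ts.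
by rewrite subrr phi0//; exact: control_shift.
Qed.

Lemma phi_coord_diff i x w s t k : control V w -> 0 <= s -> s <= t ->
  (forall r, s <= r <= t -> cdom i (phi r x w)) ->
  cmap i (phi t x w) ord0 k - cmap i (phi s x w) ord0 k =
  \int[mu]_(r in `[s, t]) F (phi r x w) (w r) i ord0 k.
Proof. by move=> cw s0 st d; have [[_ _ h] _] := hphi x cw; exact: h. Qed.

(* The time [h] is chosen so short that the integral equation contracts
   distances by L h <= 1/2, which makes Gronwall's inequality unnecessary. *)
Lemma local_flow (x0 : M) : exists (i : chart A) (h : R) (W : set M),
  [/\ 0 < h, nbhs x0 W,
    forall w y t, control V w -> W y -> 0 <= t <= h -> cdom i (phi t y w) &
    forall w y y' t, control V w -> W y -> W y' -> 0 <= t <= h ->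
      `|cmap i (phi t y w) - cmap i (phi t y' w)| <=
      2 * `|cmap i y - cmap i y'| ].
Proof.
have [i ix0] := cdom_cover A x0.
pose O := cmap i @` cdom i; pose eta0 := cmap i x0.
have Oeta0 : O eta0 by exists x0.
have [r [C [L [r0 [C0 L0] rO rC rL]]]] :=
  locally_lipschitz_rV (@cimg_open _ _ _ A i) Oeta0 cV (hF i).
(* Starting within [r / 2] of [eta0] and moving by at most [r / 4], a trajectory keeps a margin
   inside the ball of radius [r]. Adding 1 to [C] and [L] avoids division by zero. *)
have [h [h0 Ch Lh]] : exists h, [/\ 0 < h, C * h <= r / 4 & L * h <= 2^-1].
  exists (Num.min (r / 4 / (C + 1)) (2^-1 / (L + 1))).
  have C1 : 0 < C + 1 by rewrite ltr_wpDl.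
  have L1 : 0 < L + 1 by rewrite ltr_wpDl.
  split.
  - by rewrite lt_min !divr_gt0.
  - have : Num.min (r / 4 / (C + 1)) (2^-1 / (L + 1)) <= r / 4 / (C + 1).
      by rewrite ge_min lexx.
    move=> /(ler_wpM2l C0)/le_trans; apply.
    rewrite mulrCA ler_piMr// ?divr_ge0 ?ltW//.
    by rewrite ltr_pdivrMr// mul1r ltrDl.
  - have : Num.min (r / 4 / (C + 1)) (2^-1 / (L + 1)) <= 2^-1 / (L + 1).
      by rewrite ge_min lexx orbT.
    move=> /(ler_wpM2l L0)/le_trans; apply.
    rewrite mulrCA ler_piMr// ?invr_ge0 ?ltW//.
    by rewrite ltr_pdivrMr// mul1r ltrDl.
pose near_x0 (e : R) : set M := [set z | cdom i z /\ `|cmap i z - eta0| < e].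
have near_open e z : near_x0 e z -> nbhs z (near_x0 e).
  move=> [iz ze].
  have h1 : nbhs z (cdom i) by apply: open_nbhs_nbhs; split => //; exact: cdom_open.
  have h2 : \forall y \near z, `|cmap i y - eta0| < e.
    have e1 : 0 < e - `|cmap i z - eta0| by rewrite subr_gt0.
    have := @cmap_continuous _ _ _ A i z iz.
    move=> /cvgrPdist_lt /(_ _ e1); apply: filterS => y hy.
    rewrite (le_lt_trans (ler_distD (cmap i z) _ _))//.
    by rewrite distrC -ltrBrDr.
  by near=> y; split; near: y.
have FC k w y : near_x0 r y -> control V w -> forall t, `|F y (w t) i ord0 k| <= C.
  move=> [iy yr] [Vw _] t; rewrite F_chartE//; apply: (le_trans (norm_coord_le _ _)).
  by apply: rC => //; exact: ltW.
have speed w y t : control V w -> near_x0 (r / 2) y -> 0 <= t <= h ->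
    (forall s, 0 <= s <= t -> near_x0 r (phi s y w)) ->
    `|cmap i (phi t y w) - eta0| <= 3 / 4 * r.
  move=> cw [iy yr] /andP[t0 th] Hs.
  have : `|cmap i (phi t y w) - cmap i y| <= r / 4.
    apply: norm_rV_le => [|k]; first by rewrite divr_ge0// ltW.
    rewrite !mxE -{2}(phi0 y cw) phi_coord_diff//; last by move=> s /Hs[].
    have d s : 0 <= s <= t -> cdom i (phi s y w) by move=> /Hs[].
    have [C' [mf _]] := integrand_measurable_bounded hF cV k (lexx 0) (phi_within cw) cw d.
    apply: (le_trans (normr_Rintegral_itv_le t0 C0 mf _)).
      by move=> s /Hs st; exact: FC.
    by rewrite subr0 (le_trans _ Ch)// ler_wpM2l.
  have := ler_distD (cmap i y) (cmap i (phi t y w)) eta0.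
  move: yr; lra.
have stay w y t : control V w -> near_x0 (r / 2) y -> 0 <= t <= h ->
    near_x0 r (phi t y w).
  move=> cw yW.
  have near_r z e : e <= r -> near_x0 e z -> near_x0 r z.
    by move=> er [? ?]; split => //; apply: lt_le_trans er.
  have r2 : r / 2 <= r by rewrite ler_pdivrMr// ler_pMr// ler1n.
  (* Closedness in M of this compact set keeps the trajectory from leaving the
     chart at a limit time. *)
  pose Kc := cinv i @` [set eta : 'rV[R]_n | `|eta - eta0| <= 3 / 4 * r].
  have Or eta : `|eta - eta0| <= 3 / 4 * r -> O eta.
    by move=> h1; apply: rO; apply: (le_trans h1); rewrite ler_piMl// ?ltW//; lra.
  have cKc : closed Kc.
    apply: compact_closed; first exact: metric_hausdorff.
    apply: continuous_compact.
      apply/subspace_continuousP => eta /= h1.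
      by apply: cvg_within_filter; apply: cinv_continuous; exact: Or.
    apply: bounded_closed_compact.
      exists (`|eta0| + 3 / 4 * r); split; first exact: num_real.
      move=> c hc eta /= h1; apply: le_trans (ltW hc).
      rewrite -[eta](subrK eta0) addrC (le_trans (ler_normD _ _))// lerD2l.
      exact: h1.
    rewrite (_ : [set _ | _] = closed_ball_ Num.norm eta0 (3 / 4 * r)); last first.
      by apply/seteqP; split => eta; rewrite /closed_ball_/= distrC.
    exact: closed_closed_ball_.
  have Kcr z : Kc z -> near_x0 r z.
    move=> [eta eta_r <-]; have [z' iz' zE] := Or _ eta_r.
    rewrite -zE cmapK//; split => //; rewrite zE (le_lt_trans eta_r)//.
    by lra.
  move: t; apply: real_induction.
  - move=> t /andP[t0 th] before; apply: Kcr.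
    have beforeK s : 0 <= s < t -> Kc (phi s y w).
      move=> /andP[s0 st]; have [ids _] := before s ltac:(by rewrite s0).
      exists (cmap i (phi s y w)); last exact: cmapK.
      apply: speed => //=; first by rewrite s0 (le_trans (ltW st)).
      by move=> r' /andP[r'0 r's]; apply: before; rewrite r'0 (le_lt_trans r's).
    move: t0; rewrite le_eqVlt => /predU1P[<-|t0].
      rewrite phi0//; exists (cmap i y); last by case: yW => ? _; exact: cmapK.
      by case: yW => _ /= h1; move: h1; lra.
    apply: contrapT => nK.
    have [e e0 eK] : exists2 e, 0 < e & forall s, 0 <= s -> `|t - s| < e ->
        (~` Kc) (phi s y w).
      apply: phi_near => //; first exact: ltW.
      by apply: open_nbhs_nbhs; split => //; exact: closed_openC.
    pose s := Num.max 0 (t - e / 2).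
    have s0 : 0 <= s by rewrite le_max lexx.
    have st : s < t by rewrite gt_max t0/= ltrBlDr ltrDl divr_gt0.
    have ts : t - e / 2 <= s by rewrite le_max lexx orbT.
    apply: (eK s s0); last by apply: beforeK; rewrite s0.
    by rewrite ger0_norm ?subr_ge0 ?ltW//; lra.
  - move=> t /andP[t0 th] before.
    have [e e0 eK] := phi_near cw t0 (near_open _ _ (before t ltac:(by rewrite t0 lexx))).
    exists e => // s /andP[ts st]; apply: eK; first by rewrite (le_trans t0)// ltW.
    by rewrite ltr0_norm ?subr_lt0// opprB ltrBlDl.
exists i, h, (near_x0 (r / 2)); split => //.
- apply: near_open; split => //; rewrite /eta0 subrr normr0 divr_gt0//.
- by move=> w y t cw yW th; have [] := stay w y t cw yW th.
move=> w y y' t cw yW yW' th.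
pose u s := cmap i (phi s y w) - cmap i (phi s y' w).
have u0 : u 0 = cmap i y - cmap i y' by rewrite /u !phi0.
(* Any bound [S] of the difference improves to [|u 0| + S / 2]. Applied to the supremum of [|u|],
   finite because both trajectories stay in the ball of radius [r], this bounds it by
   [2 * |u 0|]. *)
have gain S : (forall s, 0 <= s <= h -> `|u s| <= S) ->
    forall s, 0 <= s <= h -> `|u s| <= `|u 0| + S / 2.
  move=> uS s /andP[s0 sh].
  have S0 : 0 <= S by apply: le_trans (uS 0 _) => //; rewrite lexx ltW.
  rewrite -[u s](subrK (u 0)) addrC (le_trans (ler_normD _ _))// lerD2l.
  have sub q : 0 <= q <= s -> 0 <= q <= h by move=> /andP[-> qs]; rewrite (le_trans qs).
  apply: norm_rV_le => [|k]; first by rewrite divr_ge0.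
  rewrite /u !mxE.
  rewrite (_ : _ - _ = (cmap i (phi s y w) ord0 k - cmap i (phi 0 y w) ord0 k) -
    (cmap i (phi s y' w) ord0 k - cmap i (phi 0 y' w) ord0 k)); last by ring.
  have d z : near_x0 (r / 2) z -> forall q, 0 <= q <= s -> cdom i (phi q z w).
    by move=> zW q /sub qh; have [] := stay w z q cw zW qh.
  rewrite !phi_coord_diff//; [|exact: d..].
  have [C1 [m1 b1]] := integrand_measurable_bounded hF cV k (lexx 0) (phi_within cw) cw (d y yW).
  have [C2 [m2 b2]] := integrand_measurable_bounded hF cV k (lexx 0) (phi_within cw) cw (d y' yW').
  rewrite -RintegralB//; [|exact: integrable_itv_bounded b1|exact: integrable_itv_bounded b2].
  have LS0 : 0 <= L * S by rewrite mulr_ge0.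
  apply: (@le_trans _ _ (L * S * (s - 0))).
    apply: normr_Rintegral_itv_le => //; first exact: measurable_funB.
    move=> q qs; have qh := sub _ qs.
    have [iy yr] := stay w y q cw yW qh; have [iy' yr'] := stay w y' q cw yW' qh.
    rewrite (F_chartE _ _ iy) (F_chartE _ _ iy'); have [Vw _] := cw.
    apply: (le_trans (rL _ _ _ _ (ltW yr) (ltW yr') (Vw q))).
    by rewrite ler_wpM2l// uS.
  rewrite subr0 mulrAC [S / 2]mulrC ler_wpM2r// (le_trans _ Lh)//.
  by rewrite ler_wpM2l.
pose E := [set `|u s| | s in `[0, h]].
have hE : has_sup E.
  split; first by exists (`|u 0|), 0 => //; rewrite /= in_itv/= lexx ltW.
  exists (r + r) => _ [s + <-]; rewrite /= in_itv/= => sh.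
  have [_ yr] := stay w y s cw yW sh; have [_ yr'] := stay w y' s cw yW' sh.
  rewrite /u (le_trans (ler_distD eta0 _ _))//.
  by rewrite lerD// ltW// distrC.
have uE s : 0 <= s <= h -> `|u s| <= sup E.
  by move=> sh; apply: ub_le_sup; [case: hE|exists s; rewrite //= in_itv].
have : sup E <= `|u 0| + sup E / 2.
  by apply: sup_le_ub; [case: hE|move=> _ [s + <-]; rewrite /= in_itv/=; exact: gain].
have := uE t th; rewrite u0 -/(u t); lra.
Unshelve. all: by end_near. Qed.

End Flow.

(** * Continuous dependence and control sets *)

Section ContinuousDependence.
Context {R : realType} {M : metricType R} {n m : nat}.
Variables (A : smooth_atlas M n) (F : vector_field_family m A).
Hypothesis hF : is_C1_family F.
Variable V : set 'rV[R]_m.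
Hypothesis cV : compact V.
Variable phi : R -> M -> (R -> 'rV[R]_m) -> M.
Hypothesis hphi : solution_map F V phi.

(** Continuity in time and initial point together, for a fixed control and nonnegative times.
    Continuity in the point at each single time would not yield the uniform tube around a trajectory
    needed later. *)
Let joint x0 w t := forall O : set M, nbhs (phi t x0 w) O ->
  exists e, 0 < e /\ \forall x \near x0, forall s, 0 <= s -> `|t - s| < e ->
    O (phi s x w).

Let joint_cvg x0 w t : joint x0 w t -> 0 <= t ->
  (phi t x w) @[x --> x0] --> phi t x0 w.
Proof.
move=> jt t0 O nO; have [e [e0]] := jt O nO; apply: filterS => x; apply => //.
by rewrite subrr normr0.
Qed.

Lemma phi_joint_continuous x0 w t : control V w -> 0 <= t -> joint x0 w t.
Proof.
move=> cw t0.
(* Continuity at time [s] alone propagates to all later times [r] within the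
   life span of the local flow at [phi c x0 w]. *)
have extend c : 0 <= c -> exists2 e, 0 < e & forall s, 0 <= s ->
    `|c - s| < e -> (phi s x w) @[x --> x0] --> phi s x0 w -> forall r, `|c - r| < e ->
    s < r \/ (s = 0 /\ r = 0) -> joint x0 w r.
  move=> c0; have [i [h [W [h0 nW dW lW]]]] := local_flow hF cV hphi (phi c x0 w).
  have [e1 e10 He1] := phi_near hphi cw c0 (nbhs_interior nW).
  exists (Num.min e1 (h / 4)); first by rewrite lt_min e10 divr_gt0.
  move=> s s0; rewrite lt_min => /andP[cs1 cs2] cvs r; rewrite lt_min => /andP[cr1 cr2] sr O nO.
  have r0 : 0 <= r by case: sr => [/ltW|[_ ->//]]; exact: le_trans.
  have Ws : nbhs (phi s x0 w) W by exact: He1.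
  have Wx0 : W (phi s x0 w) by exact: nbhs_singleton.
  have cws : control V (fun q => w (q + s)) by exact: control_shift.
  have flow q x : s <= q -> phi q x w = phi (q - s) (phi s x w) (fun q => w (q + s)).
    by move=> sq; rewrite -(phi_shift hF cV hphi).
  have srh : s <= r < s + h.
    have sr' : s <= r by case: sr => [/ltW//|[-> ->]].
    move: cs2 cr2; rewrite !ltr_norml => /andP[? ?] /andP[? ?]; lra.
  case/andP: srh => sr' rsh.
  have ir : cdom i (phi r x0 w).
    by rewrite flow//; apply: dW => //; lra.
  pose eta := cmap i (phi r x0 w).
  have Oeta : (cmap i @` cdom i) eta by exists (phi r x0 w).
  have : nbhs eta (cinv i @^-1` O).
    by apply: (@cinv_continuous _ _ _ A i _ Oeta); rewrite /eta cmapK.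
  move=> /nbhs_ballP[rho /= rho0 rhoO].
  (* The local flow at most doubles chart distances, so [rho / 4] at time [s] grows to at most
     [rho / 2]; the other half of [rho] pays for varying the time along the trajectory of [x0]. *)
  have : \forall x \near phi s x0 w, `|cmap i x - cmap i (phi s x0 w)| < rho / 4.
    have is0 : cdom i (phi s x0 w).
      by rewrite -(phi0 hphi (phi s x0 w) cw); apply: dW => //; rewrite lexx ltW.
    have rho4 : 0 < rho / 4 by rewrite divr_gt0.
    have := @cmap_continuous _ _ _ A i _ is0.
    by move=> /cvgrPdist_lt /(_ _ rho4); apply: filterS => x; rewrite distrC.
  move=> near1.
  have : \forall x \near phi r x0 w, `|cmap i x - eta| < rho / 2.
    have rho2 : 0 < rho / 2 by rewrite divr_gt0.
    have := @cmap_continuous _ _ _ A i _ ir.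
    by move=> /cvgrPdist_lt /(_ _ rho2); apply: filterS => x; rewrite distrC.
  move=> /(phi_near hphi cw r0)[e2 e20 He2].
  have [e3 [e30 He3]] : exists e3, 0 < e3 /\
      forall q, 0 <= q -> `|r - q| < e3 -> s <= q <= s + h.
    case: sr => [sr|[sE rE]].
      exists (Num.min (r - s) (s + h - r)); split.
        by rewrite lt_min !subr_gt0 sr.
      by move=> q q0; rewrite lt_min !ltr_norml => /andP[/andP[? ?] /andP[? ?]]; lra.
    exists h; split => // q q0; rewrite ltr_norml => /andP[? ?].
    by move: sE rE => -> ?; lra.
  exists (Num.min e2 e3); split; first by rewrite lt_min e20.
  have nA1 : \forall x \near x0, W (phi s x w) by exact: cvs Ws.
  have nA2 : \forall x \near x0,
    `|cmap i (phi s x w) - cmap i (phi s x0 w)| < rho / 4 by exact: cvs near1.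
  near=> x => q q0; rewrite lt_min => /andP[rq2 rq3].
  have sqh := He3 q q0 rq3.
  have Wx : W (phi s x w) by near: x.
  have dx : `|cmap i (phi s x w) - cmap i (phi s x0 w)| < rho / 4 by near: x.
  case/andP: sqh => sq qh.
  have qs : 0 <= q - s <= h by lra.
  have ix : cdom i (phi q x w) by rewrite flow//; exact: dW.
  rewrite -(cmapK ix); apply: rhoO; rewrite -ball_normE/=.
  have := lW _ _ _ _ cws Wx Wx0 qs; rewrite -!flow// => h1.
  have := He2 q q0 rq2 => h2.
  rewrite distrC (le_lt_trans (ler_distD (cmap i (phi q x0 w)) _ _))//.
  lra.
move: t0; have [T] : exists T, t <= T by exists t.
move=> tT t0; move: t {tT t0} (conj t0 tT) => t /andP.
move: t; apply: real_induction => t /andP[t0 tT] before.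
  have [e e0 He] := extend t t0.
  move: t0; rewrite le_eqVlt => /predU1P[tE|t0].
    apply: (He 0); rewrite -?tE ?subrr ?normr0//; last by right.
    rewrite (phi0 hphi x0 cw) (_ : (fun x => phi 0 x w) = id); first exact: cvg_id.
    by apply/funext => x; rewrite (phi0 hphi x cw).
  pose s := Num.max 0 (t - e / 2).
  have s0 : 0 <= s by rewrite le_max lexx.
  have st : s < t by rewrite gt_max t0/= ltrBlDr ltrDl divr_gt0.
  have ts : t - e / 2 <= s by rewrite le_max lexx orbT.
  apply: (He s) => //.
  - by rewrite ger0_norm ?subr_ge0 ?ltW//; lra.
  - by apply: joint_cvg => //; apply: before; rewrite s0.
  - by rewrite subrr normr0.
  - by left.
have [e e0 He] := extend t t0.
exists e => // s /andP[ts st]; apply: (He t) => //.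
- by rewrite subrr normr0.
- by apply: joint_cvg => //; apply: before; rewrite t0 lexx.
- by rewrite ltr0_norm ?subr_lt0// opprB ltrBlDl.
- by left.
Unshelve. all: by end_near. Qed.

Lemma phi_continuous x0 w t : control V w -> 0 <= t ->
  (phi t x w) @[x --> x0] --> phi t x0 w.
Proof. by move=> cw t0; apply: joint_cvg => //; exact: phi_joint_continuous. Qed.

Lemma phi_tube x0 w T (O : set M) : control V w -> open O ->
  (forall t, 0 <= t <= T -> O (phi t x0 w)) ->
  \forall x \near x0, forall t, 0 <= t <= T -> O (phi t x w).
Proof.
move=> cw oO H.
have /compact_near_coveringP cT := @segment_compact R 0 T.
(* The guard [0 <= t] is there because neighbourhoods of time 0 in the line contain negative times,
   where [phi] is unconstrained. *)
suff : \forall x \near x0, `[0, T]%classic `<=` (fun t => 0 <= t -> O (phi t x w)).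
  apply: filterS => x h t /[dup] tT /andP[t0 _].
  by apply: h => //=; rewrite in_itv.
apply: (cT _ (nbhs x0) (fun x t => 0 <= t -> O (phi t x w))) => t.
rewrite /= in_itv/= => tT; have t0 : 0 <= t by case/andP: tT.
have nO : nbhs (phi t x0 w) O by apply: open_nbhs_nbhs; split => //; exact: H.
have [e [e0 he]] := phi_joint_continuous cw t0 nO.
exists ([set s | `|t - s| < e],
  [set x | forall s, 0 <= s -> `|t - s| < e -> O (phi s x w)]).
  by split => //; apply/nbhs_ballP; exists e.
by move=> [s x] /= [h1 h2] s0; exact: h2.
Qed.

Lemma reach_trans x y z : reach phi V x y -> reach phi V y z -> reach phi V x z.
Proof.
move=> [s [w [s0 cw <-]]] [t [w' [t0 cw' <-]]].
exists (s + t), (concat s w w'); split; first exact: addr_gt0.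
  exact: control_concat.
rewrite (phi_concat hF cV hphi) ?addr_ge0 ?ltW// /concat.
by rewrite -[leRHS]addr0 lerD2l leNgt t0/= addrAC subrr add0r.
Qed.

(* The union of D and a trajectory arc with both ends in D satisfies the
   defining properties of a control set, so it is D by maximality. *)
Lemma control_set_arc D x w s t : control_set phi V D -> D x -> control V w ->
  0 <= s -> s <= t -> D (phi t x w) -> D (phi s x w).
Proof.
move=> [[invD appD] maxD] Dx cw s0 st Dt.
pose arc := [set phi r x w | r in `[0, t]].
suff apxD' : approx_controllable phi V (D `|` arc).
  rewrite -(maxD _ apxD'); last by move=> y; left.
  by right; exists s; rewrite //= in_itv/= s0.
have reach_end r y : 0 <= r <= t -> reach phi V (phi t x w) y ->
    reach phi V (phi r x w) y.
  move=> /andP[r0]; rewrite le_eqVlt => /predU1P[->//|rt].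
  apply: reach_trans; exists (t - r), (fun q => w (q + r)); split.
  - by rewrite subr_gt0.
  - exact: control_shift.
  - by rewrite -(phi_shift hF cV hphi)// ltW.
split.
  move=> y [Dy|[r + <-]].
    by have [w' cw' Hw'] := invD _ Dy; exists w' => // q q0; left; exact: Hw'.
  rewrite /= in_itv/= => /andP[r0 rt].
  (* From a point of the arc, follow the arc to its end in [D], then use a control that keeps the
     trajectory in [D]. *)
  have [w' cw' Hw'] := invD _ Dt.
  have cwr := control_shift r cw.
  exists (concat (t - r) (fun q => w (q + r)) w'); first exact: control_concat.
  move=> q q0; rewrite (phi_concat hF cV hphi) ?subr_ge0// /concat.
  have shiftE p : 0 <= p -> phi p (phi r x w) (fun q => w (q + r)) = phi (p + r) x w.
    by move=> p0; rewrite [RHS](phi_shift hF cV hphi x r0 _ cw) ?addrK// lerDr.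
  case: ifPn => [qt|]; last first.
    rewrite -ltNge => tq; left; rewrite shiftE ?subr_ge0// subrK; apply: Hw'.
    by rewrite subr_ge0 ltW.
  right; rewrite shiftE//; exists (q + r) => //=; rewrite in_itv/= addr_ge0//=.
  by rewrite -lerBrDr.
have appD' y : (D `|` arc) y -> D `<=` closure (reach phi V y).
  move=> [Dy|[r + <-]]; first exact: appD.
  rewrite /= in_itv/= => rt z Dz; apply: closureS (appD _ Dt _ Dz).
  by move=> z'; exact: reach_end.
move=> y Dy z [|[r + <-]]; first exact: appD'.
rewrite /= in_itv/= => /andP[r0 rt].
(* An arc point is approached by first reaching a point close to [x] and then following [w] for time
   [r]. The case [r = 0] is separate since [reach] requires positive times. *)
have := appD' _ Dy _ Dx => clx O nO.
have [x' [yx' Ox']] := clx _ (phi_continuous cw r0 nO).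
exists (phi r x' w); split => //.
move: r0; rewrite le_eqVlt => /predU1P[<-|r0]; first by rewrite (phi0 hphi x' cw).
by apply: (reach_trans yx'); exists r, w.
Qed.

(** Approximate reachability suffices because the target is open. The end point lies in [K], hence
    in [D], so the whole arc stays in [D]. *)
Lemma control_set_steer D K y : control_set phi V D -> D y -> K `<=` D ->
  K° !=set0 -> exists T w, [/\ 0 < T, control V w, K° (phi T y w) &
    forall s, 0 <= s <= T -> D (phi s y w)].
Proof.
move=> csD Dy KD [k Kk]; have [[_ appD] _] := csD.
have nk : nbhs k K° by apply: nbhs_interior.
have [z [[T [w [T0 cw <-]]] Kz]] := appD _ Dy _ (KD _ (interior_subset Kk)) _ nk.
exists T, w; split => // s /andP[s0 sT].
by apply: (control_set_arc csD Dy cw s0 sT); apply: KD; exact: interior_subset.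
Qed.

(** Ending in the interior of [K] and remaining in the open set [O] both persist for nearby starting
    points, so one control serves a neighbourhood. Remaining in [D] need not persist, as [D] need
    not be open. *)
Lemma control_set_steer_compact D K E O : control_set phi V D -> compact E ->
  E `<=` D -> K `<=` D -> D `<=` O -> open O -> K° !=set0 ->
  exists l : seq (R * (R -> 'rV[R]_m)), forall y, E y ->
    exists2 p, p \in l & [/\ 0 < p.1, control V p.2, K (phi p.1 y p.2) &
      forall s, 0 <= s <= p.1 -> O (phi s y p.2)].
Proof.
move=> csD cE ED KD DO oO K0.
apply: (@compact_finite_choice _ (R * (R -> 'rV[R]_m))%type _
  (fun p y => [/\ 0 < p.1, control V p.2, K (phi p.1 y p.2) &
      forall s, 0 <= s <= p.1 -> O (phi s y p.2)])) => // y Ey.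
have [T [w [T0 cw KT Ds]]] := control_set_steer csD (ED _ Ey) KD K0.
exists (T, w) => /=.
have h1 : \forall y' \near y, K (phi T y' w).
  apply: (phi_continuous cw (ltW T0)).
  by move: KT; rewrite /interior.
have h2 := phi_tube cw oO (fun s sT => DO _ (Ds s sT)).
by near=> y'; split => //; near: y'.
Unshelve. all: by end_near. Qed.

End ContinuousDependence.

(** * Sums and actions *)

Section Esum.
Variable R : realType.
Local Open Scope ereal_scope.

(** Different triples of controls may concatenate to the same control, so [h] is not assumed
    injective; a section [g] of it embeds the image into [X]. *)
Lemma esum_image_le (T T' : choiceType) (X : set T) (h : T -> T')
    (a : T' -> \bar R) : (forall y, 0 <= a y) ->
  \esum_(y in h @` X) a y <= \esum_(x in X) a (h x).
Proof.
move=> a0; have [->|/set0P[t0 Xt0]] := eqVneq X set0.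
  by rewrite image_set0 !esum_set0.
have /choice[g gP] : forall y, exists x, (h @` X) y -> X x /\ h x = y.
  move=> y; have [[x Xx xy]|nXy] := pselect ((h @` X) y); first by exists x.
  by exists t0.
have bij : set_bij (g @` (h @` X)) (h @` X) h.
  split.
  - by move=> _ [y hy <-] /=; have [_ ->] := gP _ hy.
  - move=> x1 x2 /[!inE] -[y1 hy1 <-] [y2 hy2 <-].
    by have [_ ->] := gP _ hy1; have [_ ->] := gP _ hy2 => ->.
  - by move=> y hy; exists (g y); [exists y|have [_] := gP _ hy].
rewrite (reindex_esum _ _ _ _ bij); apply: ge_ereal_sup => _ [Y [finY YX] <-].
apply: esum_ge; exists Y => //; split => // x /YX [y hy <-].
by have [] := gP _ hy.
Qed.

Lemma esumZl_le (T : choiceType) (X : set T) (c : R) (a : T -> \bar R) :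
  (0 <= c)%R -> (forall x, 0 <= a x) ->
  \esum_(x in X) (c%:E * a x) <= c%:E * \esum_(x in X) a x.
Proof.
move=> c0 a0; apply: ge_ereal_sup => _ [Y [finY YX] <-].
rewrite -ge0_mule_fsumr//; apply: lee_wpmul2l; first by rewrite lee_fin.
by apply: esum_ge; exists Y.
Qed.

Lemma esum_cst (T : choiceType) (X : set T) (c : R) : finite_set X ->
  (0 <= c)%R -> \esum_(x in X) c%:E = (c *+ size (finmap.enum_fset (fset_set X)))%:E.
Proof.
move=> finX c0; rewrite esum_fset// fsbig_finite//= sumEFin.
by rewrite big_const_seq count_predT iter_addr addr0.
Qed.

End Esum.

Section Action.
Context {R : realType} {m : nat}.
Variables (V : set 'rV[R]_m) (f : 'rV[R]_m -> R) (C : R).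
Hypotheses (cf : {within V, continuous f}) (fC : forall u, V u -> `|f u| <= C).
Hypothesis C0 : 0 <= C.
Notation mu := (@lebesgue_measure R).

Lemma control_integrable w s t : control V w ->
  mu.-integrable `[s, t] (EFin \o (fun r => f (w r))) /\
  measurable_fun `[s, t] (fun r => f (w r)).
Proof.
move=> [Vw mw].
have mf : measurable_fun `[s, t] (fun r => f (w r)).
  apply: (measurable_comp_rV (E := V)) => // j.
  exact: measurable_funTS.
by split => //; apply: integrable_itv_bounded mf _ => r _; exact: fC.
Qed.

Lemma integral_control_le w s t : control V w -> s <= t ->
  `|\int[mu]_(r in `[s, t]) f (w r)| <= C * (t - s).
Proof.
move=> cw st; have [_ mf] := control_integrable s t cw.
by apply: normr_Rintegral_itv_le => // r _; apply: fC; case: cw.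
Qed.

Lemma action0 w : action f 0 w = 0.
Proof. by rewrite /action set_itv1 Rintegral_set1. Qed.

Lemma action_split w s t : control V w -> 0 <= s -> s <= t ->
  action f t w = action f s w + \int[mu]_(r in `[s, t]) f (w r).
Proof.
move=> cw s0 st; rewrite /action (@Rintegral_itv_split _ _ 0 s t)//.
by have [] := control_integrable 0 t cw.
Qed.

Lemma action_concat T t w w' : 0 <= T -> 0 <= t -> control V w -> control V w' ->
  action f (T + t) (concat T w w') = action f T w + action f t w'.
Proof.
move=> T0 t0 cw cw'; have cc := control_concat T cw cw'.
rewrite (@action_split _ T)//; last by rewrite lerDl.
congr (_ + _).
  apply: eq_Rintegral => r; rewrite inE/= in_itv/= => /andP[_ rT].
  by rewrite /concat rT.
have [_ mf] := control_integrable 0 t cw'.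
have := @Rintegral_itv_shift R (fun r => f (w' r)) C T 0 t mf
  (fun r _ => fC (cw'.1 r)).
rewrite add0r [t + T]addrC /action => <-.
apply: eq_Rintegral_itv_oc.
- by have [] := control_integrable T (T + t) cc.
- have cs : control V (fun r => w' (r - T)) by exact: (control_shift (- T) cw').
  by have [] := control_integrable T (T + t) cs.
- by move=> r /andP[Tr _]; rewrite /concat leNgt Tr.
Qed.

(** With the horizon [t] unchanged, the prefix adds a piece of length [T] and pushes out the last
    piece of [w'] of the same length; each contributes at most [C * T]. If [t < T], both actions are
    at most [C * t] in absolute value. *)
Lemma action_prefix_le T t w w' : 0 <= T -> 0 <= t -> control V w ->
  control V w' -> action f t (concat T w w') <= action f t w' + 2 * C * T.
Proof.
move=> T0 t0 cw cw'; have cc := control_concat T cw cw'.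
have bnd v s : control V v -> 0 <= s -> `|action f s v| <= C * s.
  by move=> cv s0; have := integral_control_le cv s0; rewrite subr0.
have [Tt|tT] := lerP T t; last first.
  have h1 := bnd _ t cc t0; have h2 := bnd _ t cw' t0.
  have : C * t <= C * T by rewrite ler_wpM2l// ltW.
  by move: h1 h2; rewrite !ler_norml => /andP[_ ?] /andP[? _]; lra.
have tT0 : 0 <= t - T by rewrite subr_ge0.
rewrite -{1}(subrK T t) [t - T + T]addrC action_concat//.
rewrite [action f t w'](@action_split _ (t - T))//; last by rewrite gerBl.
have h1 := bnd _ T cw T0.
have := @integral_control_le w' (t - T) t cw'; rewrite gerBl => /(_ T0).
rewrite subKr; move: h1; rewrite !ler_norml => /andP[_ ?] /andP[? _].
lra.
Qed.

Lemma action_mono s t w : control V w -> 0 <= s -> s <= t ->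
  action f s w <= action f t w + C * (t - s).
Proof.
move=> cw s0 st; rewrite [action f t w](action_split cw s0 st).
by have := integral_control_le cw st; rewrite ler_norml => /andP[? _]; lra.
Qed.

End Action.

(** * Spanning sets *)

Section SpanningSets.
Context {R : realType} {M : metricType R} {n m : nat}.
Variables (A : smooth_atlas M n) (F : vector_field_family m A).
Hypothesis hF : is_C1_family F.
Variable V : set 'rV[R]_m.
Hypothesis cV : compact V.
Variable phi : R -> M -> (R -> 'rV[R]_m) -> M.
Hypothesis hphi : solution_map F V phi.
Variables (f : 'rV[R]_m -> R) (C : R).
Hypotheses (cf : {within V, continuous f}) (fC : forall u, V u -> `|f u| <= C).
Hypothesis C0 : 0 <= C.

Let cost t w : \bar R := (expR (action f t w))%:E.

Let cost_ge0 t w : (0 <= cost t w)%E.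
Proof. by rewrite lee_fin expR_ge0. Qed.

(* Follow a control of S1 up to time s, steer back into K with one of the
   controls in l, then follow a control of S2. The constant B absorbs the number
   and the lengths of the steering controls, and does not depend on s and t. *)
Lemma spanning_concat K Q1 O (l : seq (R * (R -> 'rV[R]_m))) : Q1 `<=` O ->
  (forall y, Q1 y -> exists2 p, p \in l &
    [/\ 0 < p.1, control V p.2, K (phi p.1 y p.2) &
      forall s, 0 <= s <= p.1 -> O (phi s y p.2)]) ->
  exists2 B : R, 0 < B & forall s t S1 S2 a1 a2, 0 <= s -> 0 <= t ->
    0 <= a1 -> 0 <= a2 ->
    spanning phi V s K Q1 S1 -> spanning phi V t K O S2 ->
    (\esum_(w in S1) cost s w <= a1%:E)%E ->
    (\esum_(w in S2) cost t w <= a2%:E)%E ->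
    exists2 S, spanning phi V (s + t) K O S &
      (\esum_(w in S) cost (s + t)%R w <= (B * a1 * a2)%:E)%E.
Proof.
move=> Q1O steer.
(* Only entries with positive duration and a genuine control are kept: [l] may contain others, for
   which the estimates fail. *)
pose J : set (R * (R -> 'rV[R]_m)) := [set p | p \in l /\ 0 < p.1 /\ control V p.2].
have finJ : finite_set J.
  by apply: (sub_finite_set (B := [set` l])); [move=> p []|exact: finite_seq].
pose N := size (finmap.enum_fset (fset_set J)).
have [Tb Tb_ge] : exists Tb : R, forall p, p \in l -> p.1 <= Tb.
  exists (\big[Num.max/0]_(p <- l) p.1) => p pl.
  by apply: le_bigmax_seq.
pose E := expR (2 * C * Tb).
have E0 : 0 < E by exact: expR_gt0.
(* [E] pays for the action changed by steering and [N] counts the steering controls; the successor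
   keeps the constant positive even when [J] is empty. *)
exists (E * N.+1%:R); first by rewrite mulr_gt0.
move=> s t S1 S2 a1 a2 s0 t0 a10 a20 [S1V sp1] [S2V sp2] sum1 sum2.
pose h (k : (R -> 'rV[R]_m) * ((R * (R -> 'rV[R]_m)) * (R -> 'rV[R]_m))) :=
  concat s k.1 (concat k.2.1.1 k.2.1.2 k.2.2).
pose X := S1 `*`` (fun=> J `*`` (fun=> S2)).
exists (h @` X).
  split.
    move=> _ [[w [[T v] w']] [/= S1w [/= [_ [_ cv]] S2w']] <-].
    apply: control_concat; first exact: S1V.
    by apply: control_concat => //; exact: S2V.
  move=> x Kx; have [w S1w Hw] := sp1 _ Kx.
  have Q1y : Q1 (phi s x w) by apply: Hw; rewrite s0 lexx.
  have [[T v] /= Tvl [T0 cv KT Hv]] := steer _ Q1y.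
  have [w' S2w' Hw'] := sp2 _ KT.
  exists (h (w, ((T, v), w'))); first by exists (w, ((T, v), w')).
  have cw := S1V _ S1w; have cw' := S2V _ S2w'.
  move=> r /andP[r0 rst]; rewrite /h/=.
  rewrite (phi_concat hF cV hphi)//; last exact: control_concat.
  rewrite {1}/concat; case: ifPn => [rs|].
    by apply: Q1O; apply: Hw; rewrite r0.
  rewrite -ltNge => sr; rewrite (phi_concat hF cV hphi) ?subr_ge0 ?ltW//.
  rewrite {1}/concat; case: ifPn => [rT|].
    by apply: Hv; rewrite subr_ge0 ltW.
  rewrite -ltNge => Tr; apply: Hw'; rewrite subr_ge0 ltW//=.
  by rewrite lerBlDr lerBlDl (le_trans rst)// lerD2l lerDl ltW.
apply: (le_trans (esum_image_le _ _ (cost_ge0 _))).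
apply: (@le_trans _ _ (\esum_(k in X)
    (E%:E * (cost s k.1 * cost t k.2.2)))%E).
  apply: le_esum => -[w [[T v] w']] [/= S1w [/= [Tvl [T0 cv]] S2w']].
  have cw := S1V _ S1w; have cw' := S2V _ S2w'.
  rewrite /h /cost /E -!EFinM lee_fin -!expRD ler_expR /=.
  rewrite (action_concat cf fC)//; last exact: control_concat.
  have := action_prefix_le cf fC C0 (ltW T0) t0 cv cw'.
  have : 2 * C * T <= 2 * C * Tb by rewrite ler_wpM2l ?mulr_ge0//; exact: (Tb_ge (T, v)).
  by rewrite /=; lra.
rewrite -(@esum_esum _ _ _ S1 (fun=> J `*`` (fun=> S2))
  (fun w k => E%:E * (cost s w * cost t k.2))%E); last first.
  by move=> *; rewrite !mule_ge0// lee_fin ltW.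
apply: (@le_trans _ _ (\esum_(w in S1) ((E * N%:R * a2)%:E * cost s w))%E).
  apply: le_esum => w S1w.
  rewrite -(@esum_esum _ _ _ J (fun=> S2)
    (fun p w' => E%:E * (cost s w * cost t w'))%E); last first.
    by move=> *; rewrite !mule_ge0// lee_fin ltW.
  have c0 : 0 <= E * expR (action f s w) * a2 by rewrite !mulr_ge0// ?expR_ge0// ltW.
  apply: (@le_trans _ _ (\esum_(p in J) (E * expR (action f s w) * a2)%:E)%E).
    apply: le_esum => p Jp.
    under eq_esum do rewrite muleA -EFinM.
    apply: (le_trans (esumZl_le _ _ (cost_ge0 _))).
      by rewrite mulr_ge0// ?expR_ge0// ltW.
    rewrite [leRHS]EFinM; apply: lee_wpmul2l => //.
    by rewrite lee_fin mulr_ge0// ?expR_ge0// ltW.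
  rewrite esum_cst// -EFinM lee_fin -mulr_natr -/N le_eqVlt; apply/orP; left.
  by apply/eqP; ring.
have ENa : 0 <= E * N%:R * a2 by rewrite !mulr_ge0// ltW.
apply: (le_trans (esumZl_le _ ENa (cost_ge0 _))).
apply: (@le_trans _ _ ((E * N%:R * a2)%:E * a1%:E)%E).
  by apply: lee_wpmul2l; rewrite ?lee_fin.
rewrite -EFinM lee_fin [leRHS](_ : _ = E * N.+1%:R * a2 * a1); last by ring.
do 2 apply: ler_wpM2r => //.
by rewrite ler_wpM2l ?ltW// ltr_nat.
Qed.

(** The same [S1] is prepended at every step. Only the accumulated controls have to respect the
    larger set [O], so an inequality between two different sets can still be iterated. *)
Lemma spanning_iter K Q1 O S1 (B s a : R) : K !=set0 -> K `<=` O ->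
  0 < B -> 0 <= s -> 0 < a ->
  (forall t S2 a2, 0 <= t -> 0 <= a2 ->
    spanning phi V t K O S2 -> (\esum_(w in S2) cost t w <= a2%:E)%E ->
    exists2 S, spanning phi V (s + t) K O S &
      (\esum_(w in S) cost (s + t)%R w <= (B * a * a2)%:E)%E) ->
  spanning phi V s K Q1 S1 ->
  forall k : nat, exists2 S, spanning phi V (s *+ k) K O S &
    (\esum_(w in S) cost (s *+ k)%R w <= ((B * a) ^+ k)%:E)%E.
Proof.
move=> [x0 Kx0] KO B0 s0 a0 step [S1V sp1]; elim=> [|k [S spS sumS]].
  (* At horizon 0 any single control spans, because [K] lies in [O], and its cost is 1. *)
  have [w0 S1w0 _] := sp1 _ Kx0; exists [set w0].
    split => [_ ->|x Kx]; first exact: S1V.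
    exists w0 => // t; rewrite mulr0n => t0.
    have -> : t = 0 by apply/eqP; rewrite eq_le andbC.
    by rewrite (phi0 hphi)//; [exact: KO|exact: S1V].
  by rewrite esum_set1// mulr0n /cost action0 expR0 expr0.
have sk0 : 0 <= s *+ k by rewrite mulrn_wge0.
have Bak0 : 0 <= (B * a) ^+ k by rewrite exprn_ge0// mulr_ge0// ltW.
have [S' spS' sumS'] := step _ S _ sk0 Bak0 spS sumS.
by exists S'; rewrite mulrS // exprS.
Qed.

(** Controls that span for [t] also span for [s]. As [f] may be negative, shortening the horizon can
    raise the action, by at most [C * (t - s)]. *)
Lemma inv_sum_le_of_spanning K O S s t a : 0 <= s -> s <= t ->
  spanning phi V t K O S -> (\esum_(w in S) cost t w <= a%:E)%E ->
  (inv_sum phi V f s K O <= (expR (C * (t - s)) * a)%:E)%E.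
Proof.
move=> s0 st [SV sp] sumS; apply: ge_ereal_inf; exists (\esum_(w in S) cost s w)%E.
  exists S => //; split => // x Kx; have [w Sw Hw] := sp _ Kx.
  by exists w => // r /andP[r0 rs]; apply: Hw; rewrite r0 (le_trans rs).
apply: (@le_trans _ _ (\esum_(w in S) ((expR (C * (t - s)))%:E * cost t w))%E).
  apply: le_esum => w Sw; rewrite /cost -EFinM -expRD lee_fin ler_expR addrC.
  by apply: (action_mono cf fC) => //; exact: SV.
apply: (le_trans (esumZl_le _ (expR_ge0 _) (cost_ge0 _))).
by rewrite [leRHS]EFinM; apply: lee_wpmul2l; rewrite ?lee_fin ?expR_ge0.
Qed.

Lemma inv_pressure_le_of_iter K O (s b : R) : 0 < s -> 0 < b ->
  (forall k : nat, exists2 S, spanning phi V (s *+ k) K O S &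
    (\esum_(w in S) cost (s *+ k)%R w <= (b ^+ k)%:E)%E) ->
  (inv_pressure phi V f K O <= (ln b / s)%:E)%E.
Proof.
move=> s0 b0 Hk; apply/lee_addgt0Pr => e e0.
(* Error of rounding [t] up to [s *+ k]: [C * s] for shortening the horizon back to [t], and
   [|ln b|] since [k] exceeds [t / s] by at most 1 and [ln b] may have either sign. It is at most
   [e * t] once [t >= c / e]. *)
pose c := C * s + `|ln b|.
have c0 : 0 <= c by rewrite addr_ge0// mulr_ge0// ltW.
apply: ge_ereal_inf; exists (ereal_sup
  (inv_rate phi V f K O @` [set t | (c / e) + 1 <= t])).
  by eexists; [|reflexivity]; apply: nbhs_pinfty_ge; exact: num_real.
apply: ge_ereal_sup => _ [t /= tc <-].
have t0 : 0 < t by apply: lt_le_trans tc; rewrite ltr_wpDl// divr_ge0// ltW.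
pose k := (Num.truncn (t / s)).+1.
have ts0 : 0 <= t / s by rewrite divr_ge0// ltW.
have [k1 k2] : k%:R - 1 <= t / s /\ t / s < k%:R.
  have /andP[h1 h2] := truncn_itv ts0.
  by rewrite /k h2; split => //; rewrite -natr1 addrK.
have tk : t <= s *+ k by rewrite -mulr_natr mulrC -ler_pdivrMr// ltW.
have [S spS sumS] := Hk k.
have := inv_sum_le_of_spanning (ltW t0) tk spS sumS.
set G := inv_sum _ _ _ _ _ _ => GE.
have E1 : 0 < expR (C * (s *+ k - t)) * b ^+ k.
  by rewrite mulr_gt0 ?expR_gt0// exprn_gt0.
have G0 : (0 <= G)%E.
  by apply: le_ereal_inf_tmp => _ [S' _ <-]; exact: esum_ge0.
have lnG : (lne G <= (C * (s *+ k - t) + ln b *+ k)%:E)%E.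
  have -> : (C * (s *+ k - t) + ln b *+ k)%:E =
      lne (expR (C * (s *+ k - t)) * b ^+ k)%:E.
    rewrite lne_EFin// lnM ?posrE ?expR_gt0 ?exprn_gt0//.
    by rewrite expRK lnXn.
  by rewrite lee_lne// in_itv/= ?G0 ?leey// andbT lee_fin ltW.
apply: (@le_trans _ _ ((t^-1)%:E * (C * (s *+ k - t) + ln b *+ k)%:E)%E).
  by apply: lee_wpmul2l => //; rewrite lee_fin invr_ge0 ltW.
rewrite -EFinM -EFinD lee_fin mulrC ler_pdivrMr// mulrDl.
have h1 : C * (s *+ k - t) <= C * s.
  rewrite ler_wpM2l// -mulr_natr; move: k1; rewrite ler_pdivlMr//; lra.
have h2 : ln b *+ k <= ln b / s * t + `|ln b|.
  rewrite -mulr_natr -mulrA [s^-1 * t]mulrC -lerBlDl -mulrBr.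
  apply: (le_trans (ler_norm _)); rewrite normrM ler_piMr//.
  by rewrite ler_norml; apply/andP; split; lra.
have h3 : c <= e * t.
  move: tc; rewrite -(ler_pM2l e0) mulrDr mulr1 mulrCA divff ?gt_eqF// mulr1.
  by move=> h; apply: le_trans h; rewrite lerDl ltW.
by move: h1 h2 h3; rewrite /c; lra.
Qed.

Lemma inv_pressure_le_liminf K Q1 O (l : seq (R * (R -> 'rV[R]_m))) :
  K !=set0 -> K `<=` O -> Q1 `<=` O ->
  (forall y, Q1 y -> exists2 p, p \in l &
    [/\ 0 < p.1, control V p.2, K (phi p.1 y p.2) &
      forall s, 0 <= s <= p.1 -> O (phi s y p.2)]) ->
  (inv_pressure phi V f K O <= limf_einf (inv_rate phi V f K Q1) +oo%R)%E.
Proof.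
move=> K0 KO Q1O steer; have [B B0 HB] := spanning_concat Q1O steer.
set P := inv_pressure _ _ _ _ _; set L := limf_einf _ _.
have main (r : R) : (L < r%:E)%E -> (P <= r%:E)%E.
  rewrite /L limf_einfE => Lr; apply/lee_addgt0Pr => e e0.
  (* Beyond [t0] the constant [B] contributes at most [e] to the rate; a liminf below [r] supplies
     such a time with rate below [r]. The summand 1 keeps the time positive. *)
  pose t0 := `|ln B| / e + 1.
  have : (ereal_inf (inv_rate phi V f K Q1 @` [set t | (t0 <= t)%R]) < r%:E)%E.
    apply: le_lt_trans Lr; apply: ereal_sup_ubound.
    by eexists; [|reflexivity]; apply: nbhs_pinfty_ge; exact: num_real.
  move=> /ereal_inf_lt[_ [t /= t0t <-] rate_r].
  have tpos : 0 < t by apply: lt_le_trans t0t; rewrite ltr_wpDl// divr_ge0// ltW.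
  have : (inv_sum phi V f t K Q1 < (expR (t * r))%:E)%E.
    have lnr : (lne (inv_sum phi V f t K Q1) < (t * r)%:E)%E.
      by move: rate_r; rewrite /inv_rate lte_pdivrMl// ; rewrite -EFinM.
    have S0 : (0 <= inv_sum phi V f t K Q1)%E.
      apply: le_ereal_inf_tmp => _ [S' _ <-]; exact: esum_ge0.
    by rewrite -[ltLHS]lneK ?in_itv/= ?S0 ?leey// (lte_expeR _ (t * r)%:E).
  move=> /ereal_inf_lt[_ [S1 spS1 <-] /ltW sumS1].
  have ePos := expR_gt0 (t * r).
  have step t' S2 a2 : 0 <= t' -> 0 <= a2 -> spanning phi V t' K O S2 ->
      (\esum_(w in S2) cost t' w <= a2%:E)%E ->
      exists2 S, spanning phi V (t + t') K O S &
        (\esum_(w in S) cost (t + t')%R w <= (B * expR (t * r) * a2)%:E)%E.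
    by move=> t'0 a20 spS2 sumS2; apply: (HB t t' S1 S2) => //; exact: ltW.
  have Bpos : 0 < B * expR (t * r) by rewrite mulr_gt0.
  have := inv_pressure_le_of_iter tpos Bpos
    (spanning_iter K0 KO B0 (ltW tpos) ePos step spS1).
  move/le_trans; apply; rewrite -EFinD lee_fin lnM ?posrE// expRK.
  rewrite ler_pdivrMr// mulrDl addrC [t * r]mulrC lerD2l.
  apply: (le_trans (ler_norm _)); move: t0t.
  rewrite /t0 -(ler_pM2l e0) mulrDr mulr1 mulrCA divff ?gt_eqF// mulr1.
  by move=> h; apply: le_trans h; rewrite lerDl ltW.
case: L main => [L| |] main; last 2 first.
- exact: leey.
- by rewrite leeNy_eq; apply/eqP/eq_ninfty => r; apply: main; exact: ltNyr.
apply/lee_addgt0Pr => e e0; rewrite -EFinD; apply: main.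
by rewrite lte_fin ltrDl.
Qed.

End SpanningSets.

(** * Limits *)

Section LimitsOfRates.
Variable R : realType.
Local Open Scope ereal_scope.

Lemma limf_esup_mono (u v : R -> \bar R) :
  (forall t, (0 < t)%R -> u t <= v t) -> limf_esup u +oo%R <= limf_esup v +oo%R.
Proof.
move=> uv; apply: le_ereal_inf_tmp => _ [X nX <-].
apply: ge_ereal_inf; exists (ereal_sup (u @` (X `&` [set t | (0 < t)%R]))).
  eexists; [|reflexivity]; apply: filterI => //.
  by apply: nbhs_pinfty_gt; exact: num_real.
apply: ge_ereal_sup => _ [t [Xt /= t0] <-].
by apply: le_ereal_sup_tmp; exists (v t); [exists t|exact: uv].
Qed.

Lemma limf_einf_mono (u v : R -> \bar R) :
  (forall t, (0 < t)%R -> u t <= v t) -> limf_einf u +oo%R <= limf_einf v +oo%R.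
Proof.
by move=> uv; rewrite leeN2; apply: limf_esup_mono => t t0; rewrite leeN2 uv.
Qed.

Lemma limf_einf_le_esup (u : R -> \bar R) : limf_einf u +oo%R <= limf_esup u +oo%R.
Proof.
rewrite limf_einfE; apply: ge_ereal_sup => _ [X nX <-].
apply: le_ereal_inf_tmp => _ [Y nY <-].
have [t [Xt Yt]] := @filter_ex _ _ _ _ (filterI nX nY).
apply: (@le_trans _ _ (u t)); first by apply: ereal_inf_lbound; exists t.
by apply: ereal_sup_ubound; exists t.
Qed.

End LimitsOfRates.

(** * Metric neighbourhoods and the comparison of their rates *)

Lemma open_eps_nbhd (R : realType) (M : metricType R) (e : R) (Q : set M) :
  open (eps_nbhd e Q).
Proof.
rewrite openE => y [x Qx xy]; rewrite /interior.
have e0 : 0 < e - mdist x y by rewrite subr_gt0.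
apply/nbhs_ballP; exists (e - mdist x y) => // z; rewrite ballEmdist/= => yz.
exists x => //; rewrite (le_lt_trans (metric_triangle _ y _))//.
by rewrite addrC -ltrBrDr.
Qed.

(** A Lebesgue number argument: if the ball of radius [r] at [x] lies in [G], then [r / 2] serves
    every centre within [r / 2] of [x]. *)
Lemma compact_eps_nbhd_sub (R : realType) (M : metricType R) (Q G : set M) :
  compact Q -> open G -> Q `<=` G -> exists2 d : R, 0 < d & eps_nbhd d Q `<=` G.
Proof.
move=> /compact_near_coveringP cQ oG QG.
have : \forall d \near (0 : R)^'+,
    Q `<=` (fun x => forall y, mdist x y < d -> G y).
  apply: (cQ _ ((0 : R)^'+) (fun d x => forall y, mdist x y < d -> G y)) => x Qx.
  have : nbhs x G by apply: open_nbhs_nbhs; split => //; exact: QG.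
  move=> /nbhs_ballP[r /= r0 rG].
  have r20 : 0 < r / 2 by rewrite divr_gt0.
  exists (ball x (r / 2), [set d | d < r / 2]).
    by split; [exact: nbhsx_ballx|exact: nbhs_right_lt].
  move=> [x' d] /= [xx' dr] y x'y; apply: rG; rewrite (splitr r).
  apply: (ball_triangle xx'); rewrite ballEmdist/=.
  exact: lt_trans dr.
move=> nd.
have [d [d0 Hd]] : exists d : R, 0 < d /\
    Q `<=` (fun x => forall y, mdist x y < d -> G y).
  have := filter_ex (filterI (nbhs_right_gt (0 : R)) nd).
  by move=> [d [d0 Hd]]; exists d.
by exists d => // y [x Qx xy]; exact: Hd xy.
Qed.

Lemma inv_rate_mono (R : realType) (M : metricType R) (m : nat)
    (phi : R -> M -> (R -> 'rV[R]_m) -> M) V f K Q Q' t : 0 < t -> Q `<=` Q' ->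
  (inv_rate phi V f K Q' t <= inv_rate phi V f K Q t)%E.
Proof.
move=> t0 QQ'; apply: lee_wpmul2l; first by rewrite lee_fin invr_ge0 ltW.
have G0 P : (0 <= inv_sum phi V f t K P)%E.
  by apply: le_ereal_inf_tmp => _ [S _ <-]; apply: esum_ge0 => w _; rewrite lee_fin expR_ge0.
rewrite lee_lne ?in_itv/= ?G0 ?leey//.
apply: ereal_inf_le_tmp => _ [S [SV sp] <-]; exists S => //.
split => // x Kx; have [w Sw Hw] := sp _ Kx.
by exists w => // s /Hw /QQ'.
Qed.

Lemma controlW (R : realType) (m : nat) (V V' : set 'rV[R]_m) w : V `<=` V' ->
  control V w -> control V' w.
Proof. by move=> VV' [Vw mw]; split => // t; exact: VV'. Qed.

Theorem proposition5p1 (R : realType) (M : metricType R) (n m : nat)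
    (A : smooth_atlas M n) (F : vector_field_family m A)
    (hF : is_C1_family F)
    (phi : R -> M -> (R -> 'rV[R]_m) -> M)
    (U : set 'rV[R]_m) (UU : R -> set 'rV[R]_m) (D : set M)
    (hphi : forall rho, 0 <= rho <= 1 -> solution_map F (UU rho) phi)
    (hD : inner_control_set phi U D UU) :
  forall K : set M, K !=set0 -> compact K -> K `<=` D ->
    admissible phi (UU 1) K (closure D) /\
    (K° !=set0 ->
     forall f0 f : 'rV[R]_m -> R,
       {within U, continuous f0} -> {within UU 1, continuous f} ->
       (forall u, U u -> f u = f0 u) ->
       limf_einf (inv_rate phi (UU 1) f K (eps_nbhd eps (closure D))) +oo
         @[eps --> 0^'+] --> outer_pressure phi (UU 1) f K (closure D)).
Proof.
move=> K K0 cK KD; have KQ : K `<=` closure D by move=> x /KD; exact: subset_closure.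
have [csD cU monoU [DD [DDcs [U0 D0] DDmono DDnbhs]]] := hD.
have U01 : U `<=` UU 1 by rewrite U0; apply: monoU; rewrite ?ltr01.
split.
  split => //; first by have [x /KQ] := K0; exists x.
  move=> x /KD Dx; have [[inv _] _] := csD; have [w cw Hw] := inv _ Dx.
  exists w; first exact: controlW cw.
  by move=> t t0; apply: subset_closure; exact: Hw.
move=> intK f0 f _ cf _.
have cU1 : compact (UU 1) by have [] := cU 1; rewrite // ler01 lexx.
have hphi1 : solution_map F (UU 1) phi by apply: hphi; rewrite ler01 lexx.
have [C C0 fC] : exists2 C, 0 <= C & forall u, UU 1 u -> `|f u| <= C.
  have /compact_bounded[C [_ HC]] := continuous_compact cf cU1.
  exists (`|C| + 1); first by rewrite addr_ge0.
  by move=> u Uu; apply: HC; [rewrite (le_lt_trans (ler_norm _))// ltrDl|exists u].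
pose Q := closure D.
pose P eps := inv_pressure phi (UU 1) f K (eps_nbhd eps Q).
pose L eps := limf_einf (inv_rate phi (UU 1) f K (eps_nbhd eps Q)) +oo.
have nbhdS (e e' : R) : e <= e' -> eps_nbhd e Q `<=` eps_nbhd e' Q.
  by move=> ee' y [x Qx xy]; exists x => //; exact: lt_le_trans ee'.
have PL eps : 0 < eps -> exists2 d : R, 0 < d & (P eps <= L d)%E.
  move=> eps0; pose O := eps_nbhd eps Q.
  have QO : Q `<=` O by move=> x Qx; exists x => //; rewrite mdistxx.
  have [rho /andP[rho0 rho1] DDO] : exists2 rho, 0 < rho < 1 & closure (DD rho) `<=` O.
    by apply: DDnbhs => x Qx; apply: open_nbhs_nbhs; split; [exact: open_eps_nbhd|exact: QO].
  have r20 : 0 < rho / 2 by rewrite divr_gt0.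
  have r2r : rho / 2 < rho by rewrite ltr_pdivrMr// ltr_pMr// ltr1n.
  have DD0 : closure (DD 0) `<=` (DD (rho / 2))°.
    by apply: DDmono; rewrite // ltW// (lt_trans r2r).
  have DDr : closure (DD (rho / 2)) `<=` (DD rho)°.
    by apply: DDmono; rewrite // ltW.
  have [_ _ cE] : [/\ control_set phi (UU (rho / 2)) (DD (rho / 2)),
      (DD (rho / 2))° !=set0 & compact (closure (DD (rho / 2)))].
    by apply: DDcs; rewrite ltW//= ltW// (lt_trans r2r).
  have cQ : compact Q.
    by rewrite /Q D0; have [] := DDcs 0; rewrite // lexx ler01.
  have QDD : Q `<=` (DD (rho / 2))° by rewrite /Q D0.
  have [d d0 dQ] := compact_eps_nbhd_sub cQ (@open_interior _ (DD (rho / 2))) QDD.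
  have rho01 : 0 <= rho <= 1 by rewrite !ltW.
  have [csr _ _] := DDcs _ rho01.
  have KDr : K `<=` DD rho.
    move=> x /KQ; rewrite D0 => /DD0/interior_subset/subset_closure/DDr.
    exact: interior_subset.
  have ED : closure (DD (rho / 2)) `<=` DD rho.
    by move=> x /DDr; exact: interior_subset.
  have DrO : DD rho `<=` O by move=> x /subset_closure; exact: DDO.
  (* Steering takes place in the system with range [UU rho], where [DD rho] is a control set. Its
     controls are also controls with values in [UU 1], and both systems share [phi]. *)
  have [cUr _] := cU _ rho01.
  have [l Hl] := control_set_steer_compact hF cUr (hphi _ rho01) csr cE ED KDr DrO
    (@open_eps_nbhd _ _ eps Q) intK.
  exists d => //.
  have dE y : eps_nbhd d Q y -> closure (DD (rho / 2)) y.
    by move=> /dQ/interior_subset; exact: subset_closure.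
  apply: (inv_pressure_le_liminf hF cU1 hphi1 cf fC C0 K0 (l := l)).
  - by move=> x /KDr; exact: DrO.
  - by move=> y /dE/ED; exact: DrO.
  - move=> y /dE/Hl[p pl [p0 cp Kp Op]]; exists p => //; split => //.
    by apply: controlW cp; apply: monoU; rewrite // ltW.
(* Both quantities increase as [eps] decreases, so their limits are suprema over [eps > 0], and in a
   supremum the passage from [eps] to [d] costs nothing. *)
have cvgP : P eps @[eps --> 0^'+] --> ereal_sup (P @` `]0, +oo[).
  apply: nonincreasing_at_right_cvge => // e e' _ _ ee'.
  by apply: limf_esup_mono => t t0; apply: inv_rate_mono => //; exact: nbhdS.
have cvgL : L eps @[eps --> 0^'+] --> ereal_sup (L @` `]0, +oo[).
  apply: nonincreasing_at_right_cvge => // e e' _ _ ee'.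
  by apply: limf_einf_mono => t t0; apply: inv_rate_mono => //; exact: nbhdS.
have -> : outer_pressure phi (UU 1) f K (closure D) = ereal_sup (L @` `]0, +oo[).
  rewrite /outer_pressure (cvg_lim _ cvgP)//.
  apply/eqP; rewrite eq_le; apply/andP; split; apply: ge_ereal_sup => _ [e + <-];
    rewrite /= in_itv/= andbT => e0.
    have [d d0 Pd] := PL _ e0; apply: (le_trans Pd); apply: ereal_sup_ubound.
    by exists d => //=; rewrite in_itv/= d0.
  apply: (le_trans (limf_einf_le_esup _)); apply: ereal_sup_ubound.
  by exists e => //=; rewrite in_itv/= e0.
exact: cvgL.
Qed.
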